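(* Suppose that $\mathbb M$ has definable Skolem functions. Let $X$ and $Y$ be Hausdorff definable spaces with $Y$ locally definably compact. Let $f:X\to Y$ be a continuous definable map. Then the following are equivalent: (1) $f$ is definably proper. (2) For every definable type $\alpha$ on $X$, if $\tilde f(\alpha)$ has a limit in $Y$, then $\alpha$ has a limit in $X$.
   Context: $\mathbb M=(M,<,\ldots)$ is an arbitrary o-minimal structure; ''definable'' means definable in $\mathbb M$, possibly with parameters. $\mathbb M$ has definable Skolem functions if for every uniformly definable family $\{F_t\}_{t\in T}$ of nonempty definable sets there is a definable map $f:T\to\bigcup_t F_t$ with $f(t)\in F_t$ for all $t\in T$. A definable space is a set $X=\bigcup_{i\le k}X_i$ with injections (definable charts) $\theta_i:X_i\to M^{n_i}$ ($i\le k$, $k$ finite) such that each $\theta_i(X_i)$ is a definable subset of $M^{n_i}$ (with the induced topology), each $\theta_i(X_i\cap X_j)$ is an open definable subset of $\theta_i(X_i)$, and each transition map $\theta_j\circ\theta_i^{-1}:\theta_i(X_i\cap X_j)\to\theta_j(X_i\cap X_j)$ is a definable homeomorphism. $X$ carries the topology in which each $X_i$ is open and each $\theta_i$ is a homeomorphism. A subset $A\subseteq X$ is definable if each $\theta_i(A\cap X_i)$ is definable; it is then itself a definable space with the induced topology. A map $f:X\to Y$ between definable spaces with charts $(X_i,\theta_i)$, $(Y_j,\delta_j)$ is definable if each $\delta_j\circ f\circ\theta_i^{-1}$ (on its natural domain) is a definable map between definable sets. A definable curve in a definable subset $C\subseteq X$ is a continuous definable map $\alpha:(a,b)\to C$,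 with $a<b$ in $M\cup\{-\infty,+\infty\}$; it is completable in $C$ if both limits $\lim_{t\to a^+}\alpha(t)$ and $\lim_{t\to b^-}\alpha(t)$ exist in $C$. $C$ is definably compact if every definable curve in $C$ is completable in $C$. $X$ is locally definably compact if every $x\in X$ has a definably compact (definable) neighborhood. A continuous definable map $f:X\to Y$ is definably proper if $f^{-1}(K)$ is a definably compact definable subset of $X$ for every definably compact definable subset $K$ of $Y$. A type on $X$ is an ultrafilter $\alpha$ of definable subsets of $X$. It is a definable type on $X$ if for every uniformly definable family $\{F_t\}_{t\in T}$ of definable subsets of $X$, with $T\subseteq M^n$ for some $n$, there is a definable subset $T(\alpha)\subseteq T$ such that $F_t\in\alpha$ if and only if $t\in T(\alpha)$. A point $x\in X$ is a limit of $\alpha$ if $U\in\alpha$ for every open definable subset $U$ of $X$ with $x\in U$. For a definable map $f:X\to Y$ and a definable type $\alpha$ on $X$, $\tilde f(\alpha)$ is the definable type on $Y$ given by $\{A\subseteq Y \text{ definable}: f^{-1}(A)\in\alpha\}$. *)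

(* Defs.v *)
From HB Require Import structures.
From mathcomp Require Import all_boot all_order all_algebra.
From mathcomp Require Import all_classical.
From mathcomp Require Import topology.

Set Implicit Arguments.
Unset Strict Implicit.
Unset Printing Implicit Defensive.

Import Order.TTheory GRing.Theory.

Local Open Scope classical_set_scope.
Local Open Scope ring_scope.

(** * First-order structures *)

(* The symbol [<] is not listed in the language: it is a logical symbol of
   [formula], always read as the order of the underlying ordered type. *)
Record language := Language {
  funs : Type;
  fun_arity : funs -> nat;
  rels : Type;
  rel_arity : rels -> nat
}.

Inductive term (L : language) : Type :=
  | Var of nat
  | App (s : funs L) of ('I_(fun_arity s) -> term L).

(* Variables are de Bruijn indices. *)
Inductive formula (L : language) : Type :=
  | Eq of term L & term L
  | Lt of term L & term L
  | Rel (s : rels L) of ('I_(rel_arity s) -> term L)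
  | Not of formula L
  | And of formula L & formula L
  | Exists of formula L.

Record structure (L : language) (M : Type) := Structure {
  fun_interp : forall s : funs L, 'rV[M]_(fun_arity s) -> M;
  rel_interp : forall s : rels L, set 'rV[M]_(rel_arity s)
}.

Definition env_cons (M : Type) (a : M) (e : nat -> M) (k : nat) : M :=
  if k is k'.+1 then e k' else a.

(* The first [n] variables are the entries of [x], the next ones are read in
   [e]. *)
Definition env_row (M : Type) (n : nat) (x : 'rV[M]_n) (e : nat -> M)
    (k : nat) : M :=
  if insub k is Some i then x ord0 i else e (k - n)%N.

Section Definable.
Context {d : Order.disp_t} {M : orderTopologicalType d} {L : language}.
Variable S : structure L M.

Fixpoint eval (e : nat -> M) (t : term L) : M :=
  match t with
  | Var k => e k
  | App s ts => fun_interp S (\row_i eval e (ts i))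
  end.

Fixpoint holds (e : nat -> M) (p : formula L) : Prop :=
  match p with
  | Eq t u => eval e t = eval e u
  | Lt t u => (eval e t < eval e u)%O
  | Rel s ts => rel_interp S (\row_i eval e (ts i))
  | Not q => ~ holds e q
  | And q r => holds e q /\ holds e r
  | Exists q => exists a : M, holds (env_cons a e) q
  end.

(* The environment [e] provides the parameters; only finitely many of its
   values matter. *)
Definition definable (n : nat) (A : set 'rV[M]_n) : Prop :=
  exists (p : formula L) (e : nat -> M), A = [set x | holds (env_row x e) p].

Definition definable_fun (n m : nat) (D : set 'rV[M]_n)
    (f : 'rV[M]_n -> 'rV[M]_m) : Prop :=
  definable [set row_mx x (f x) | x in D].

Definition definable_family (n m : nat) (T : set 'rV[M]_n)
    (F : 'rV[M]_n -> set 'rV[M]_m) : Prop :=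
  definable T /\
  definable [set z : 'rV[M]_(n + m) | T (lsubmx z) /\ F (lsubmx z) (rsubmx z)].

Definition has_definable_skolem : Prop :=
  forall (n m : nat) (T : set 'rV[M]_n) (F : 'rV[M]_n -> set 'rV[M]_m),
    definable_family T F -> (forall t, T t -> F t !=set0) ->
    exists f : 'rV[M]_n -> 'rV[M]_m,
      definable_fun T f /\ (forall t, T t -> F t (f t)).

(* Following the usual convention, the order is a nonempty dense linear order
   without endpoints. *)
Record o_minimal : Prop := OMinimal {
  omin_nonempty : [set: M] !=set0;
  omin_dense : forall a b : M, (a < b)%O -> exists c, (a < c < b)%O;
  omin_nomin : forall a : M, exists b, (b < a)%O;
  omin_nomax : forall a : M, exists b, (a < b)%O;
  omin_tame : forall A : set M,
    definable [set x : 'rV[M]_1 | A (x ord0 ord0)] ->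
    exists (s : seq M) (I : seq (interval M)),
      all itv_open_ends I /\
      A = [set` s] `|` \bigcup_(i in [set` I]) [set` i]
}.

(** * Definable spaces *)

(* Charts are total functions whose values outside of their domain are
   irrelevant.  The inverse of the transition map from chart [i] to chart [j]
   is the one from [j] to [i], so that requiring all of them to be continuous
   makes them homeomorphisms. *)
Record defspace := DefSpace {
  carrier :> Type;
  nchart : nat;
  dim : 'I_nchart -> nat;
  dom : 'I_nchart -> set carrier;
  chart : forall i : 'I_nchart, carrier -> 'rV[M]_(dim i);
  dom_cover : \bigcup_i dom i = setT;
  chart_inj : forall i, set_inj (dom i) (chart i);
  chart_definable : forall i, definable (chart i @` dom i);
  overlap_definable : forall i j, definable (chart i @` (dom i `&` dom j));
  overlap_open : forall i j, exists2 V : set 'rV[M]_(dim i),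
    open V & chart i @` (dom i `&` dom j) = chart i @` dom i `&` V;
  transition : forall i j, exists tau : 'rV[M]_(dim i) -> 'rV[M]_(dim j),
    [/\ forall x, (dom i `&` dom j) x -> tau (chart i x) = chart j x,
        definable_fun (chart i @` (dom i `&` dom j)) tau
      & {within chart i @` (dom i `&` dom j), continuous tau}]
}.

End Definable.

Arguments dim {_ _ _ _} X i : rename.
Arguments dom {_ _ _ _} X i _ : rename.
Arguments chart {_ _ _ _} X i _ : rename.

Section Topology.
Context {d : Order.disp_t} {M : orderTopologicalType d} {L : language}.
Context {S : structure L M}.
Variable X : defspace S.

Definition defspace_open : set_system X := [set U | forall i,
  exists2 V : set 'rV[M]_(dim X i),
    open V & chart X i @` (dom X i `&` U) = chart X i @` dom X i `&` V].

Let inj i x y : dom X i x -> dom X i y -> chart X i x = chart X i y -> x = y.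
Proof. by move=> Dx Dy; apply: chart_inj; exact: mem_set. Qed.

Let opP U : defspace_open U <-> forall i, exists2 V : set 'rV[M]_(dim X i),
  open V & forall x, dom X i x -> U x <-> V (chart X i x).
Proof.
split=> H i; have [V oV VE] := H i; exists V => //.
  move=> x Dx; split=> [Ux|Vx].
    suff: (chart X i @` dom X i `&` V) (chart X i x) by case.
    by rewrite -VE; exists x.
  have : (chart X i @` dom X i `&` V) (chart X i x) by split => //; exists x.
  by rewrite -VE => -[y [Dy Uy]] /inj <-.
rewrite eqEsubset; split=> [_ [x [Dx Ux] <-]|_ [[x Dx <-] Vx]].
  by split; [exists x|exact/VE].
by exists x => //; split => //; exact/VE.
Qed.

Lemma defspace_openT : defspace_open setT.
Proof. by apply/opP => i; exists setT => //; exact: openT. Qed.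

Lemma defspace_openI : setI_closed defspace_open.
Proof.
move=> A B /opP oA /opP oB; apply/opP => i.
have [V oV VE] := oA i; have [W oW WE] := oB i.
exists (V `&` W); first exact: openI.
by move=> x Dx; split=> -[? ?]; split; [exact/VE|exact/WE|exact/VE|exact/WE].
Qed.

Lemma defspace_open_bigU (I : Type) (f : I -> set X) :
  (forall k, defspace_open (f k)) -> defspace_open (\bigcup_k f k).
Proof.
move=> of_; apply/opP => i.
have /choice[V VP] k : exists V : set 'rV[M]_(dim X i),
    open V /\ forall x, dom X i x -> f k x <-> V (chart X i x).
  by have /opP/(_ i)[V ? ?] := of_ k; exists V.
exists (\bigcup_k V k); first by apply: bigcup_open => k _; have [] := VP k.
by move=> x Dx; split=> -[k _ Hk]; exists k => //; apply/(VP k).2.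
Qed.

HB.instance Definition _ := gen_eqMixin (carrier X).
HB.instance Definition _ := gen_choiceMixin (carrier X).
HB.instance Definition _ := isOpenTopological.Build (carrier X)
  defspace_openT defspace_openI defspace_open_bigU.

Lemma defspace_openE : open = defspace_open. Proof. by []. Qed.

(* Every [dom X i] is open and every [chart X i] is a homeomorphism from
   [dom X i] onto its image. *)
Lemma open_dom i : open (dom X i).
Proof.
rewrite defspace_openE => j; rewrite setIC.
by have [V oV VE] := overlap_open j i; exists V => //; rewrite setIC.
Qed.

Lemma open_chartP i (U : set X) : U `<=` dom X i ->
  open U <-> exists2 V : set 'rV[M]_(dim X i),
    open V & chart X i @` U = chart X i @` dom X i `&` V.
Proof.
move=> Ui; split=> [|[V oV VE]].
  by rewrite defspace_openE => /(_ i); rewrite (setIidr Ui).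
rewrite defspace_openE; apply/opP => j.
have [W oW WE] := overlap_open j i.
have [tau [tauE _ /continuousP ctau]] := @transition _ _ _ _ X j i.
have /open_subspaceP[W' oW' W'E] := ctau _ oV.
exists (W `&` W'); first exact: openI.
have VP x : dom X i x -> U x <-> V (chart X i x).
  move=> Dx; split=> [Ux|Vx].
    suff: (chart X i @` dom X i `&` V) (chart X i x) by case.
    by rewrite -VE; exists x.
  have : (chart X i @` dom X i `&` V) (chart X i x) by split => //; exists x.
  by rewrite -VE => -[y Uy] /(inj (Ui _ Uy)) <-.
move=> x Dj.
have W'P : dom X i x -> W' (chart X j x) <-> V (chart X i x).
  move=> Di; set A := chart X j @` (dom X j `&` dom X i) in W'E.
  have Ax : A (chart X j x) by exists x.
  rewrite -(tauE x)//; split=> [W'x|Vx].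
    have : (W' `&` A) (chart X j x) by [].
    by rewrite W'E => -[].
  have : (tau @^-1` V `&` A) (chart X j x) by [].
  by rewrite -W'E => -[].
split=> [Ux|[Wx W'x]].
  have Di := Ui _ Ux; split; last exact/W'P/VP.
  suff: (chart X j @` dom X j `&` W) (chart X j x) by case.
  by rewrite -WE; exists x.
have : (chart X j @` dom X j `&` W) (chart X j x) by split => //; exists x.
rewrite -WE => -[y [Dy Diy]] /inj yx; have Di : dom X i x by rewrite -yx.
exact/VP/W'P.
Qed.

End Topology.

Section DefinableSpaces.
Context {d : Order.disp_t} {M : orderTopologicalType d} {L : language}.
Context {S : structure L M}.
Implicit Types X Y : defspace S.

Definition definable_set X (A : set X) : Prop :=
  forall i, definable S (chart X i @` (A `&` dom X i)).

(* The graphs of the partial maps [chart Y j \o f \o (chart X i)^-1]. *)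
Definition definable_map X Y (f : X -> Y) : Prop :=
  forall i j, definable S
    [set row_mx (chart X i x) (chart Y j (f x)) |
      x in dom X i `&` f @^-1` dom Y j].

Definition definable_set_family X (n : nat) (T : set 'rV[M]_n)
    (F : 'rV[M]_n -> set X) : Prop :=
  definable S T /\
  forall i, definable_family S T (fun t => chart X i @` (F t `&` dom X i)).

(** ** Definable curves and definable compactness *)

(* A map on the interval [I] is given by a total map on [M] whose values outside
   of [I] are irrelevant. *)
Record definable_curve X (C : set X) (I : interval M) (alpha : M -> X) : Prop :=
  DefinableCurve {
    curve_open : itv_open_ends I;
    curve_nonempty : [set` I] !=set0;
    curve_in : forall t, t \in I -> C (alpha t);
    curve_continuous : {within [set` I], continuous alpha};
    curve_definable : forall i, definable S
      [set row_mx (const_mx t : 'rV[M]_1) (chart X i (alpha t)) |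
        t in [set` I] `&` alpha @^-1` dom X i]
  }.

(* The filters t --> a^+ and t --> b^- on I = (a, b), with a and b possibly
   infinite. *)
Definition left_end (I : interval M) : set_system M :=
  [set A | exists2 c, c \in I & forall t, t \in I -> (t < c)%O -> A t].
Definition right_end (I : interval M) : set_system M :=
  [set A | exists2 c, c \in I & forall t, t \in I -> (c < t)%O -> A t].

Definition completable X (C : set X) (I : interval M) (alpha : M -> X) : Prop :=
  (exists2 x, C x & alpha @ left_end I --> x) /\
  (exists2 x, C x & alpha @ right_end I --> x).

Definition definably_compact X (C : set X) : Prop :=
  forall (I : interval M) (alpha : M -> X),
    definable_curve C I alpha -> completable C I alpha.

Definition locally_definably_compact X : Prop :=
  forall x : X, exists K : set X,
    [/\ nbhs x K, definable_set K & definably_compact K].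

Definition definably_proper X Y (f : X -> Y) : Prop :=
  forall K : set Y, definable_set K -> definably_compact K ->
    definable_set (f @^-1` K) /\ definably_compact (f @^-1` K).

(** ** Types *)

Record type_on X (alpha : set_system X) : Prop := TypeOn {
  type_definable : forall A, alpha A -> definable_set A;
  typeT : alpha setT;
  type0 : ~ alpha set0;
  typeI : forall A B, alpha A -> alpha B -> alpha (A `&` B);
  typeS : forall A B, definable_set B -> A `<=` B -> alpha A -> alpha B;
  type_ultra : forall A, definable_set A -> alpha A \/ alpha (~` A)
}.

Record definable_type X (alpha : set_system X) : Prop := DefinableType {
  definable_type_on : type_on alpha;
  definable_type_def :
    forall (n : nat) (T : set 'rV[M]_n) (F : 'rV[M]_n -> set X),
      definable_set_family T F ->
      exists Talpha : set 'rV[M]_n,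
        [/\ definable S Talpha, Talpha `<=` T
          & forall t, T t -> alpha (F t) <-> Talpha t]
}.

Definition type_limit X (alpha : set_system X) (x : X) : Prop :=
  forall U : set X, open U -> definable_set U -> U x -> alpha U.

Definition type_map X Y (f : X -> Y) (alpha : set_system X) : set_system Y :=
  [set A | definable_set A /\ alpha (f @^-1` A)].

End DefinableSpaces.

(* Main.v *)
Require Import Defs.
From mathcomp Require Import all_boot all_order all_algebra.
From mathcomp Require Import all_classical.
From mathcomp Require Import topology.

Set Implicit Arguments.
Unset Strict Implicit.
Unset Printing Implicit Defensive.

Import Order.TTheory.

Local Open Scope classical_set_scope.

(** Let [K] be a definably compact definable set belonging to a definable type
    [alpha].  The half-spaces [{x in dom j | x_k < c}] and [{x in dom j | x_k > c}]
    that are not in [alpha], together with the chart domains not in [alpha], form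
    finitely many monotone one-parameter families of open sets, and no choice of
    one member in each of them covers [K].  Replacing one family after the other
    by its union, one gets a point of [K] outside of all of them; such a point is
    a limit of [alpha].  Each replacement works for the following reason: if the
    sets [K \ G c] are nonempty for a monotone family [G], a definable choice of
    points in them is continuous near the end of the family, hence is a curve in
    [K], and its limit lies in all of them.  For the continuity it is enough that
    a definable unary function has a point of continuity in every interval, so
    cell decomposition is not needed.
    Conversely, the end of a definable curve in [f @^-1` K] is a definable type,
    and the image of this type converges because the image of the curve does. *)

(** Finitely many sets outside of an ultrafilter never cover one of its members, which is why no
    choice of one member per family covers [K]. The obstacle is that the union of a whole family of
    half-spaces outside of [alpha] may belong to [alpha], so being outside of [alpha] is lost as
    soon as a family is replaced by its union. The induction in [avoid_small_halves] therefore
    carries an open set [G] outside of [alpha], which collects one member of each family already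
    met; compactness is used only after the induction hypothesis has been applied to every
    enlargement of [G] by one further member. Definability of [alpha] makes the parameters of each
    family a definable set; o-minimality then gives this set an end and an interval on which the
    curve can live, and Skolem functions give the curve. The order of [M] need not be complete:
    suprema are available for definable sets only, and come from their decomposition into points and
    open intervals. *)

Fixpoint term_rename (L : language) (s : nat -> nat) (t : term L) : term L :=
  match t with
  | Var k => Var L (s k)
  | App h ts => App (fun i => term_rename s (ts i))
  end.

Definition rename_lift (s : nat -> nat) (k : nat) : nat :=
  if k is k'.+1 then (s k').+1 else 0.

Fixpoint formula_rename (L : language) (s : nat -> nat) (p : formula L) :
    formula L :=
  match p with
  | Eq t u => Eq (term_rename s t) (term_rename s u)
  | Lt t u => Lt (term_rename s t) (term_rename s u)
  | Rel r ts => Rel (fun i => term_rename s (ts i))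
  | Not q => Not (formula_rename s q)
  | And q r => And (formula_rename s q) (formula_rename s r)
  | Exists q => Exists (formula_rename (rename_lift s) q)
  end.

Definition env_shift (M : Type) (n : nat) (rho : nat -> M) (k : nat) : M :=
  rho (n + k).

(** * Definable predicates on environments *)

Section DefinablePredicates.
Context {d : Order.disp_t} {M : orderTopologicalType d} {L : language}.
Variable S : structure L M.
Implicit Types rho e : nat -> M.

Lemma eval_rename e s (t : term L) :
  Defs.eval S e (term_rename s t) = Defs.eval S (e \o s) t.
Proof.
elim: t => //= h ts IH; congr (fun_interp S _).
by apply/rowP => i; rewrite !mxE IH.
Qed.

Lemma holds_rename e s (p : formula L) :
  holds S e (formula_rename s p) <-> holds S (e \o s) p.
Proof.
elim: p e s => [t u|t u|r ts|q IH|q IHq r IHr|q IH] e s /=;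
  rewrite ?eval_rename //.
- have -> : (\row_i Defs.eval S e (term_rename s (ts i)))%R =
    (\row_i Defs.eval S (e \o s) (ts i))%R.
    by apply/rowP => i; rewrite !mxE eval_rename.
  by [].
- by split=> nh /IH.
- by split=> -[/IHq ? /IHr ?].
- have E a : env_cons a e \o rename_lift s = env_cons a (e \o s).
    by apply/funext => -[].
  by split=> -[a] h; exists a; move: h; rewrite IH E.
Qed.

Lemma holds_ext e e' p : e = e' -> holds S e p <-> holds S e' p.
Proof. by move=> ->. Qed.

Definition ref_eval (c : nat + M) rho : M :=
  match c with inl i => rho i | inr a => a end.

(* A predicate on environments is definable when it is given by a formula each
   variable of which is interpreted by an entry of the environment or by a
   parameter. *)
Definition dpred (Q : (nat -> M) -> Prop) : Prop :=
  exists (p : formula L) (g : nat -> nat + M),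
    forall rho, Q rho <-> holds S (fun k => ref_eval (g k) rho) p.

(** These are the terms that can replace a variable in a [dpred] by a mere change of interpretation,
    with no new quantifier. *)
Definition simple (t : (nat -> M) -> M) : Prop :=
  exists c, t = ref_eval c.

Definition simplev (n : nat) (x : (nat -> M) -> 'rV[M]_n) : Prop :=
  forall i, simple (fun rho => x rho ord0 i).

Lemma simple_var k : simple (fun rho => rho k).
Proof. by exists (inl k). Qed.

Lemma simplev_row n (t : (nat -> M) -> 'I_n -> M) :
  (forall i, simple (t^~ i)) -> simplev (fun rho => \row_i t rho i)%R.
Proof.
by move=> h i; have [c hc] := h i; exists c; apply/funext => rho; rewrite !mxE -hc.
Qed.

Lemma simplev_cst n (x : 'rV[M]_n) : simplev (fun=> x).
Proof. by move=> i; exists (inr (x ord0 i)). Qed.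

Lemma simplev_const n t : simple t -> simplev (fun rho => const_mx (t rho) : 'rV_n).
Proof. by move=> [c ->] i; exists c; apply/funext => rho; rewrite mxE. Qed.

Lemma simplev_row_mx n m (x : (nat -> M) -> 'rV[M]_n) (y : (nat -> M) -> 'rV[M]_m) :
  simplev x -> simplev y -> simplev (fun rho => row_mx (x rho) (y rho)).
Proof.
move=> hx hy i; case: (split_ordP i) => k ->.
  have [c hc] := hx k; exists c; rewrite -hc.
  by apply/funext => rho; rewrite row_mxEl.
have [c hc] := hy k; exists c; rewrite -hc.
by apply/funext => rho; rewrite row_mxEr.
Qed.

Lemma simplev_lsubmx n m (x : (nat -> M) -> 'rV[M]_(n + m)) :
  simplev x -> simplev (fun rho => lsubmx (x rho)).
Proof.
by move=> h i; have [c hc] := h (lshift m i); exists c; rewrite -hc;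
  apply/funext => rho; rewrite mxE.
Qed.

Lemma simplev_rsubmx n m (x : (nat -> M) -> 'rV[M]_(n + m)) :
  simplev x -> simplev (fun rho => rsubmx (x rho)).
Proof.
by move=> h i; have [c hc] := h (rshift n i); exists c; rewrite -hc;
  apply/funext => rho; rewrite mxE.
Qed.

Lemma simple_entry n (x : (nat -> M) -> 'rV[M]_n) i :
  simplev x -> simple (fun rho => x rho ord0 i).
Proof. by []. Qed.

Lemma dpred_ext Q Q' : (forall rho, Q rho <-> Q' rho) -> dpred Q -> dpred Q'.
Proof.
by move=> QQ' [p [g h]]; exists p, g => rho; rewrite -QQ'.
Qed.

Lemma dpred_not Q : dpred Q -> dpred (fun rho => ~ Q rho).
Proof. by move=> [p [g h]]; exists (Not p), g => rho; rewrite h. Qed.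

Lemma dpred_and Q R : dpred Q -> dpred R -> dpred (fun rho => Q rho /\ R rho).
Proof.
move=> [p [g hp]] [q [h hq]].
(* The two formulas get disjoint variables, the even ones for [p] and the odd ones for [q], so that
   one interpretation of variables serves both. *)
exists (And (formula_rename double p) (formula_rename (fun k => k.*2.+1) q)).
exists (fun k => if odd k then h k./2 else g k./2) => rho /=.
rewrite !holds_rename hp hq.
have -> : (fun k => ref_eval (if odd k then h k./2 else g k./2) rho) \o double
  = (fun k => ref_eval (g k) rho).
  by apply/funext => k /=; rewrite odd_double doubleK.
have -> : (fun k => ref_eval (if odd k then h k./2 else g k./2) rho) \o
    (fun k => k.*2.+1) = (fun k => ref_eval (h k) rho).
  by apply/funext => k /=; rewrite odd_double /= uphalf_double.
by [].
Qed.

Lemma dpred_or Q R : dpred Q -> dpred R -> dpred (fun rho => Q rho \/ R rho).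
Proof.
move=> hQ hR.
apply: dpred_ext (dpred_not (dpred_and (dpred_not hQ) (dpred_not hR))) => rho.
by rewrite not_andE !notK.
Qed.

Lemma dpred_imp (Q R : (nat -> M) -> Prop) :
  dpred Q -> dpred R -> dpred (fun rho => Q rho -> R rho).
Proof.
move=> hQ hR; apply: dpred_ext (dpred_or (dpred_not hQ) hR) => rho.
by split=> [[//|//]|h]; have [/h|] := pselect (Q rho); [right|left].
Qed.

Lemma dpred_ex (P : M -> (nat -> M) -> Prop) :
  dpred (fun rho => P (rho 0) (env_shift 1 rho)) ->
  dpred (fun rho => exists a, P a rho).
Proof.
move=> [p [g h]].
(* Several variables of [p] may stand for entry 0; all of them are merged into the bound variable 0.
   The others move up by one, while the entries they refer to move down by one; the value chosen for
   [inl 0] is never read. *)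
pose s k := if g k is inl 0 then 0 else k.+1.
exists (Exists (formula_rename s p)).
exists (fun k => match g k with inl i => inl i.-1 | inr a => inr a end) => rho /=.
suff E a : P a rho <-> holds S (env_cons a (fun k => ref_eval
    (match g k with inl i => inl i.-1 | inr b => inr b end) rho))
    (formula_rename s p) by split=> -[a ?]; exists a; exact/E.
rewrite holds_rename -[P a rho]/(P (env_cons a rho 0) (env_shift 1 (env_cons a rho))).
rewrite h; set e1 := (X in holds S X p); set e2 := (X in _ <-> holds S X p).
suff -> : e1 = e2 by [].
apply/funext => k; rewrite /e1 /e2 /= /s.
by case E: (g k) => [[|i]|b] /=; rewrite ?E.
Qed.

Lemma dpred_all (P : M -> (nat -> M) -> Prop) :
  dpred (fun rho => P (rho 0) (env_shift 1 rho)) ->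
  dpred (fun rho => forall a, P a rho).
Proof.
move=> /dpred_not/(@dpred_ex (fun a rho => ~ P a rho))/dpred_not.
apply: dpred_ext => rho; split=> [h a|h [a]]; last by apply.
by apply: contrapT => n; apply: h; exists a.
Qed.

Lemma dpred_cst (A : Prop) (a : M) : dpred (fun=> A).
Proof.
have [hA|nA] := pselect A.
  by exists (Eq (Var L 0) (Var L 0)), (fun=> inr a).
by exists (Not (Eq (Var L 0) (Var L 0))), (fun=> inr a) => rho /=; split.
Qed.

Lemma dpred_fin (a : M) (I : finType) (Q : I -> (nat -> M) -> Prop) :
  (forall i, dpred (Q i)) -> dpred (fun rho => exists i, Q i rho).
Proof.
move=> h.
suff H (s : seq I) : dpred (fun rho => exists2 i, i \in s & Q i rho).
  apply: dpred_ext (H (enum I)) => rho; split=> [[i _ ?]|[i ?]]; exists i => //.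
  by rewrite mem_enum.
elim: s => [|i s IH].
  by apply: dpred_ext (dpred_cst False a) => rho; split=> // -[].
apply: dpred_ext (dpred_or (h i) IH) => rho; split.
  move=> [?|[j js ?]]; first by exists i => //; exact: mem_head.
  by exists j => //; rewrite inE js orbT.
by move=> [j]; rewrite inE => /orP[/eqP->|js] ?; [left|right; exists j].
Qed.

Lemma dpred_eq_simple t u : simple t -> simple u -> dpred (fun rho => t rho = u rho).
Proof.
move=> [c ->] [c' ->].
by exists (Eq (Var L 0) (Var L 1)), (fun k => if k is 0 then c else c').
Qed.

Lemma dpred_lt_simple t u :
  simple t -> simple u -> dpred (fun rho => (t rho < u rho)%O).
Proof.
move=> [c ->] [c' ->].
by exists (Lt (Var L 0) (Var L 1)), (fun k => if k is 0 then c else c').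
Qed.

Lemma dpred_set n (A : set 'rV[M]_n) (x : (nat -> M) -> 'rV[M]_n) :
  definable S A -> simplev x -> dpred (fun rho => A (x rho)).
Proof.
move=> [p [e ->]] /choice[c hc].
exists p, (fun k => if insub k is Some i then c i else inr (e (k - n))) => rho /=.
apply: holds_ext; apply/funext => k; rewrite /env_row.
by case: insub => //= i; rewrite -hc.
Qed.

Lemma dpredP (a : M) n (A : set 'rV[M]_n) :
  dpred (fun rho => A (\row_(i < n) rho i)%R) <-> definable S A.
Proof.
split=> [[p [g h]]|hA]; last first.
  by apply: dpred_set => //; apply: simplev_row => i; exact: simple_var.
(* Parameters and entries from [n] on both become variables from [n] on: the truth of [A] at the row
   does not depend on those entries, which can be frozen at [a]. *)
exists (formula_rename (fun k => match g k with
  | inl i => if i < n then i else n + k | inr _ => n + k end) p).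
exists (fun k => if g k is inr b then b else a).
rewrite predeqE => x /=.
pose rho k := env_row x (fun=> a) k.
have {1}-> : x = (\row_(i < n) rho i)%R.
  by apply/rowP => i; rewrite mxE /rho /env_row valK.
rewrite h holds_rename; apply: holds_ext; apply/funext => k /=.
rewrite /rho /env_row; case gk: (g k) => [i|b] /=.
  have [lin|nlt] := ltnP i n; first by rewrite insubT.
  by rewrite !insubF ?ltnNge ?leq_addr ?nlt ?addKn //= gk.
by rewrite insubF ?ltnNge ?leq_addr //= addKn gk.
Qed.

Lemma dpred_exv n (P : 'rV[M]_n -> (nat -> M) -> Prop) :
  dpred (fun rho => P (\row_(i < n) rho i)%R (env_shift n rho)) ->
  dpred (fun rho => exists x, P x rho).
Proof.
(* The vector is replaced by a whole environment [v] of which only the first [k] entries are read,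
   so that the quantifiers can be removed one at a time. *)
have H k (Q : (nat -> M) -> Prop) : dpred Q -> dpred (fun rho =>
    exists v : nat -> M, Q (fun i => if i < k then v i else rho (i - k))).
  elim: k Q => [|k IH] Q hQ.
    apply: dpred_ext hQ => rho.
    have E v : (fun i => if i < 0 then v i else rho (i - 0)) = rho.
      by apply/funext => i; rewrite subn0.
    by split=> [?|[v]]; rewrite ?E //; exists rho; rewrite E.
  have hQ' : dpred (fun rho => exists a, Q (env_cons a rho)).
    apply: (@dpred_ex (fun a rho => Q (env_cons a rho))).
    by apply: dpred_ext hQ => rho; have -> : env_cons (rho 0) (env_shift 1 rho)
      = rho by apply/funext => -[].
  apply: dpred_ext (IH _ hQ') => rho.
  have E a v : env_cons a (fun i => if i < k then v i else rho (i - k)) =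
      fun i => if i < k.+1 then env_cons a v i else rho (i - k.+1).
    by apply/funext => -[//|i] /=; rewrite ltnS subSS.
  split; first by move=> [v [a]]; rewrite E => h; exists (env_cons a v).
  move=> [v h]; exists (env_shift 1 v), (v 0); rewrite E.
  by have -> : env_cons (v 0) (env_shift 1 v) = v by apply/funext => -[].
move=> /(H n); apply: dpred_ext => rho.
have E v : env_shift n (fun i => if i < n then v i else rho (i - n)) = rho.
  by apply/funext => i; rewrite /env_shift ltnNge leq_addr /= addKn.
split=> [[v]|[x h]]; first by rewrite E => h; eexists; exact: h.
exists (env_row x rho); rewrite E.
have -> : (\row_(i < n) (if (i < n)%N then env_row x rho i else rho (i - n)%N))%R = x.
  by apply/rowP => i; rewrite mxE ltn_ord /env_row valK.
by [].
Qed.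

End DefinablePredicates.

(** * Definable terms and substitution of variables *)

Section DefinableTerms.
Context {d : Order.disp_t} {M : orderTopologicalType d} {L : language}.
Variable S : structure L M.

(* Flags let one statement cover both sides of a point and both directions of
   monotonicity. *)
Definition ltb (b : bool) (x y : M) : bool := if b then (x < y)%O else (y < x)%O.

Lemma dpred_subst (Q : (nat -> M) -> Prop) (s : (nat -> M) -> nat -> M) :
  (forall k, simple (s^~ k)) -> dpred S Q -> dpred S (fun rho => Q (s rho)).
Proof.
move=> /choice[c hc] [p [g h]].
exists p, (fun k => if g k is inl i then c i else g k) => rho; rewrite h.
apply: holds_ext; apply/funext => k; case: (g k) => //= i.
by rewrite -hc.
Qed.

Definition dterm (t : (nat -> M) -> M) : Prop :=
  dpred S (fun rho => t (env_shift 1 rho) = rho 0).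

Definition dfun (f : M -> M) : Prop := dpred S (fun rho => f (rho 0) = rho 1).

Lemma dterm_simple t : simple t -> dterm t.
Proof.
move=> [c ->]; apply: dpred_eq_simple (simple_var 0).
by case: c => [i|a]; [exists (inl i.+1)|exists (inr a)].
Qed.

Lemma dterm_app f t : dfun f -> dterm t -> dterm (fun rho => f (t rho)).
Proof.
move=> hf ht.
apply: (@dpred_ext _ _ _ _ (fun rho => exists a, t (env_shift 1 rho) = a /\ f a = rho 0)).
  by move=> rho; split=> [[a [->]]|<-] //; exists (t (env_shift 1 rho)).
apply: (@dpred_ex _ _ _ _ (fun a rho => t (env_shift 1 rho) = a /\ f a = rho 0)).
apply: dpred_and.
  apply: (dpred_subst (Q := fun rho => t (env_shift 1 rho) = rho 0)
    (s := fun rho => env_cons (rho 0) (env_shift 2 rho)) _ ht).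
  by move=> -[|k]; eexists (inl _).
apply: (dpred_subst (Q := fun rho => f (rho 0) = rho 1)
  (s := fun rho => env_cons (rho 0) (fun=> rho 1)) _ hf).
by move=> -[|k]; eexists (inl _).
Qed.

Lemma dterm_rel (R : M -> M -> Prop) t u :
  dpred S (fun rho => R (rho 1) (rho 0)) ->
  dterm t -> dterm u -> dpred S (fun rho => R (t rho) (u rho)).
Proof.
move=> hR ht hu.
apply: (@dpred_ext _ _ _ _
  (fun rho => exists x y, (t rho = x /\ u rho = y) /\ R x y)).
  by move=> rho; split=> [[x [y [[-> ->]]]]|?] //; exists (t rho), (u rho).
apply: (@dpred_ex _ _ _ _
  (fun x rho => exists y, (t rho = x /\ u rho = y) /\ R x y)).
apply: (@dpred_ex _ _ _ _ (fun y rho => (t (env_shift 1 rho) = rho 0 /\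
  u (env_shift 1 rho) = y) /\ R (rho 0) y)).
apply: dpred_and => //; apply: dpred_and.
  apply: (dpred_subst (Q := fun rho => t (env_shift 1 rho) = rho 0)
    (s := fun rho => env_cons (rho 1) (env_shift 2 rho)) _ ht).
  by move=> -[|k]; eexists (inl _).
apply: (dpred_subst (Q := fun rho => u (env_shift 1 rho) = rho 0)
  (s := fun rho => env_cons (rho 0) (env_shift 2 rho)) _ hu).
by move=> -[|k]; eexists (inl _).
Qed.

Lemma dpred_eq t u : dterm t -> dterm u -> dpred S (fun rho => t rho = u rho).
Proof. by apply: dterm_rel; apply: dpred_eq_simple; exact: simple_var. Qed.

Lemma dpred_ltb b t u :
  dterm t -> dterm u -> dpred S (fun rho => ltb b (t rho) (u rho)).
Proof.
apply: (@dterm_rel (fun x y => ltb b x y)).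
by case: b; apply: dpred_lt_simple; exact: simple_var.
Qed.

Lemma dpred_negb (Q : (nat -> M) -> bool) :
  dpred S Q -> dpred S (fun rho => ~~ Q rho).
Proof.
by move=> /dpred_not; apply: dpred_ext => rho; split=> /negP.
Qed.

Lemma dpred_ex2 (P Q : M -> (nat -> M) -> Prop) :
  dpred S (fun rho => P (rho 0) (env_shift 1 rho) /\
                      Q (rho 0) (env_shift 1 rho)) ->
  dpred S (fun rho => exists2 a, P a rho & Q a rho).
Proof.
move=> /(@dpred_ex _ _ _ _ (fun a rho => P a rho /\ Q a rho)).
by apply: dpred_ext => rho; split=> [[a []]|[a]]; exists a.
Qed.

End DefinableTerms.

(** * Automated proofs of definability *)

Ltac simple_tac :=
  lazymatch goal with
  | |- simple (fun rho => @fun_of_matrix _ _ _ _ _ _) =>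
      apply: simple_entry; simplev_tac
  | |- simple _ => solve [eexists (inl _); reflexivity | eexists (inr _); reflexivity]
  end
with simplev_tac :=
  lazymatch goal with
  | |- simplev (fun rho => row_mx _ _) => apply: simplev_row_mx; simplev_tac
  | |- simplev (fun rho => lsubmx _) => apply: simplev_lsubmx; simplev_tac
  | |- simplev (fun rho => rsubmx _) => apply: simplev_rsubmx; simplev_tac
  | |- simplev (fun rho => const_mx _) => apply: simplev_const; simple_tac
  | |- simplev (fun rho => \row_i _)%R =>
       let i := fresh "i" in apply: simplev_row => i; simple_tac
  | |- simplev _ => apply: simplev_cst
  end.

Ltac dterm_tac :=
  first [ apply: dterm_simple; simple_tac
        | apply: dterm_app; [eassumption | dterm_tac] ].

Ltac dfn :=
  lazymatch goal with
  | |- dpred _ (fun rho => _ /\ _) => apply: dpred_and; dfn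
  | |- dpred _ (fun rho => _ \/ _) => apply: dpred_or; dfn
  | |- dpred _ (fun rho => ~ _) => apply: dpred_not; dfn
  | |- dpred _ (fun rho => exists a, @?P rho a) =>
      first [ tryif refine (@dpred_ex _ _ _ _ (fun a rho => P rho a) _)
              then idtac
              else refine (@dpred_exv _ _ _ _ _ (fun a rho => P rho a) _);
              cbv beta; dfn
            | idtac ]
  | |- dpred _ (fun rho => exists2 a, @?P rho a & @?Q rho a) =>
      refine (@dpred_ex2 _ _ _ _ (fun a rho => P rho a) (fun a rho => Q rho a) _);
      cbv beta; dfn
  | |- dpred _ (fun rho => forall a, @?P rho a) =>
      first [ apply: dpred_imp
            | refine (@dpred_all _ _ _ _ (fun a rho => P rho a) _); cbv beta ]; dfn
  | |- dpred _ (fun rho => is_true (~~ _)) => apply: dpred_negb; dfn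
  | |- dpred _ (fun rho => is_true (ltb _ _ _)) => apply: dpred_ltb; dterm_tac
  | |- dpred _ (fun rho => @eq _ _ _) => first [apply: dpred_eq; dterm_tac | idtac]
  | |- _ => first [ eassumption | idtac]
  end.

(** * Tameness along one-sided approaches *)

Section OrderFlags.
Context {d : Order.disp_t} {M : orderTopologicalType d}.
Implicit Types x y z : M.

Lemma ltbN b x y : ltb (~~ b) x y = ltb b y x. Proof. by case: b. Qed.

Lemma ltbxx b x : ltb b x x = false.
Proof. by case: b; rewrite /ltb ltxx. Qed.

Lemma ltb_trans b y x z : ltb b x y -> ltb b y z -> ltb b x z.
Proof. by case: b; rewrite /ltb => h k; [exact: lt_trans k|exact: lt_trans h]. Qed.

Lemma ltb_total b x y : [\/ ltb b x y, x = y | ltb b y x].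
Proof. by case: b; rewrite /ltb; case: ltgtP => ?; by [constructor|constructor 2]. Qed.

Lemma ltb_asym b x y : ltb b x y -> ~~ ltb b y x.
Proof. by move=> h; apply/negP => /(ltb_trans h); rewrite ltbxx. Qed.

Lemma ltb_le_trans b y x z : ltb b x y -> ~~ ltb b z y -> ltb b x z.
Proof. by case: (ltb_total b y z) => [k h _|-> //|-> //]; exact: ltb_trans k. Qed.

Lemma le_ltb_trans b y x z : ~~ ltb b y x -> ltb b y z -> ltb b x z.
Proof. by case: (ltb_total b x y) => [h _|-> //|-> //]; exact: ltb_trans. Qed.

End OrderFlags.

Section Tameness.
Context {d : Order.disp_t} {M : orderTopologicalType d} {L : language}.
Variables (S : structure L M) (S_omin : o_minimal S).
Implicit Types (x y z : M) (A B C : set M) (b : bool).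

Definition dset A : Prop := dpred S (fun rho => A (rho 0)).

Lemma ltb_dense b x y : ltb b x y -> exists z, ltb b x z /\ ltb b z y.
Proof.
by case: b => /(omin_dense S_omin)[z /andP[? ?]]; exists z.
Qed.

Lemma ltb_unbounded b x : exists y, ltb b x y.
Proof. by case: b; [exact: omin_nomax S_omin x|exact: omin_nomin S_omin x]. Qed.

Lemma ltb_dense2 b x y z : ltb b x y -> ltb b x z ->
  exists t, [/\ ltb b x t, ltb b t y & ltb b t z].
Proof.
move=> xy xz; have [yz|->|zy] := ltb_total b y z.
- have [t [xt ty]] := ltb_dense xy; exists t; split=> //; exact: ltb_trans yz.
- by have [t [xt tz]] := ltb_dense xz; exists t.
- have [t [xt tz]] := ltb_dense xz; exists t; split=> //; exact: ltb_trans zy.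
Qed.

(* [None] is an infinite endpoint. *)
Definition bound b (o : option M) x : bool := if o is Some u then ltb b u x else true.

(** The decomposition given by o-minimality, with the two ends of each interval listed in the order
    in which the direction [b] meets them. All later uses of tameness go through this form. *)
Lemma dset_pieces b A : dset A -> exists (s : seq M) (P : seq (option M * option M)),
  forall x, A x <-> x \in s \/
    exists2 q, q \in P & bound b q.1 x /\ bound (~~ b) q.2 x.
Proof.
move=> dA; have [a _] := omin_nonempty S_omin.
have /(omin_tame S_omin)[s [I [/allP oI AE]]] :
    definable S [set x : 'rV[M]_1 | A (x ord0 ord0)].
  by apply/(dpredP S a); apply: dpred_ext dA => rho /=; rewrite mxE.
pose e (i : itv_bound M) := if i is BSide _ u then Some u else None.
pose c (i : interval M) := let: Interval l r := i in
  if b then (e l, e r) else (e r, e l).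
have cP i x : i \in I -> x \in i <-> bound b (c i).1 x /\ bound (~~ b) (c i).2 x.
  move=> /oI oi; suff -> : (x \in i) = bound b (c i).1 x && bound (~~ b) (c i).2 x.
    by split=> [/andP|[? ?]] //; apply/andP.
  move: oi; rewrite /c /bound /ltb; case: i => [[[]u|[]] [[]w|[]]] //= _;
  by case: (b); rewrite in_itv /= ?andbT // andbC.
exists s, (map c I) => x; rewrite AE; split.
  move=> [?|[i /= iI xi]]; [by left|right; exists (c i)].
    exact: map_f.
  exact/cP.
move=> [?|[_ /mapP[i iI ->] /(cP _ _ iI) xi]]; first by left.
by right; exists i.
Qed.

(* [E] is a nonempty initial segment, without greatest element, for the order
   [ltb b]; it stands for a point approached from one side, or for an infinite
   endpoint. *)
Definition cut b (E : set M) : Prop :=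
  [/\ exists x, E x, forall x y, ltb b x y -> E y -> E x
    & forall x, E x -> exists2 y, E y & ltb b x y].

Definition eventually_at b (E : set M) A : Prop :=
  exists2 c, E c & forall t, E t -> ltb b c t -> A t.

Lemma cut_lt b x : cut b [set t | ltb b t x].
Proof.
split=> /=.
- by have [y xy] := ltb_unbounded (~~ b) x; exists y; rewrite -ltbN.
- by move=> y z; exact: ltb_trans.
- by move=> y /ltb_dense[z [yz zx]]; exists z.
Qed.

Section Cut.
Variables (b : bool) (E : set M) (cE : cut b E).
Local Notation ev := (eventually_at b E).

Lemma eventually_and A B : ev A -> ev B -> ev (A `&` B).
Proof.
move=> [c Ec cA] [c' Ec' cB]; have [cc'|cc'|c'c] := ltb_total b c c'.
- by exists c' => // t Et h; split; [apply: cA => //; exact: ltb_trans h|exact: cB].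
- by rewrite -cc' in cB; exists c => // t Et h; split; [exact: cA|exact: cB].
- by exists c => // t Et h; split; [exact: cA|apply: cB => //; exact: ltb_trans h].
Qed.

Lemma eventually_sub A B : A `<=` B -> ev A -> ev B.
Proof. by move=> AB [c Ec h]; exists c => // t Et ct; exact/AB/h. Qed.

Lemma eventually_ex A : ev A -> forall c, E c -> exists t, [/\ E t, ltb b c t & A t].
Proof.
move=> evA c Ec; have [_ _ nmax] := cE.
have /(eventually_and evA)[e Ee h] : ev [set t | ltb b c t] by exists c.
by have [t Et et] := nmax _ Ee; have [] := h t Et et; exists t.
Qed.

Lemma eventually_exF A : ev A -> ev (~` A) -> False.
Proof.
move=> h k; have [[x Ex] _ _] := cE.
by have [t [_ _ []]] := eventually_ex (eventually_and h k) Ex.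
Qed.

Definition decided A : Prop := ev A \/ ev (~` A).

Lemma eventually_all A : (forall t, E t -> A t) -> ev A.
Proof. by have [[c Ec] _ _] := cE => h; exists c => // t /h. Qed.

(** A bound [u] in [E] is passed by a tail of [E], and a bound outside of [E] is never reached, so a
    half-line is settled in both cases. *)
Lemma decided_bound b' o : decided (bound b' o).
Proof.
case: o => [u|]; last by left; apply: eventually_all.
have [_ down _] := cE.
have [Eu|nEu] := pselect (E u).
  have [->|nb] := eqVneq b' b; first by left; exists u.
  right; exists u => // t Et ut /=; have -> : b' = ~~ b by move: nb; case: b' (b) => -[].
  by rewrite /= ltbN; apply/negP; exact: ltb_asym.
have lt_u t : E t -> ltb b t u.
  by move=> Et; have [//|tu|/down/(_ Et)//] := ltb_total b t u; rewrite -tu in nEu.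
have [->|nb] := eqVneq b' b.
  right; apply: eventually_all => t /lt_u tu; apply/negP; exact: ltb_asym.
left; apply: eventually_all => t /lt_u tu /=.
by have -> : b' = ~~ b; [move: nb; case: b' (b) => -[]|rewrite ltbN].
Qed.

Lemma decided_and A B : decided A -> decided B -> decided (fun x => A x /\ B x).
Proof.
move=> [hA|nA] [hB|nB]; first by left; exact: eventually_and.
- by right; apply: eventually_sub nB => x ? [].
- by right; apply: eventually_sub nA => x ? [].
- by right; apply: eventually_sub nB => x ? [].
Qed.

Lemma decided_pt x : decided [set x].
Proof.
right; have [[c Ec] down nmax] := cE; have [Ex|nEx] := pselect (E x).
  by exists x => // t _ xt /= tx; rewrite tx ltbxx in xt.
by apply: eventually_all => t Et /= tx; rewrite tx in Et.
Qed.

(** Each interval is settled near the end of [E] and a single point is left behind there, so a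
    finite union that holds eventually does so through one of its intervals. *)
Lemma decided_pieces (s : seq M) (P : seq (option M * option M)) :
  ev (fun x => x \in s \/ exists2 q, q \in P & bound b q.1 x /\ bound (~~ b) q.2 x) ->
  exists2 q, q \in P & ev (fun x => bound b q.1 x /\ bound (~~ b) q.2 x).
Proof.
elim: s => [|a s IH].
  elim: P => [|q P IHP] h.
    exfalso; apply: (eventually_exF h); apply: eventually_all => t _ [//|[//]].
  have [hq|nq] := decided_and (decided_bound b q.1) (decided_bound (~~ b) q.2).
    by exists q => //; exact: mem_head.
  have [|r rP ?] := IHP; last by exists r => //; rewrite inE rP orbT.
  apply: eventually_sub (eventually_and nq h) => x [nqx [//|[r]]].
  by rewrite inE => /orP[/eqP->//|rP] ?; right; exists r.
move=> h; apply: IH; have [ha|na] := decided_pt a.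
  have := eventually_and ha h => -[c Ec k]; have [_ _ nmax] := cE.
  exfalso; have [y Ey cy] := nmax _ Ec; have [z Ez yz] := nmax _ Ey.
  have [/= ya _] := k _ Ey cy; have [/= za _] := k _ Ez (ltb_trans cy yz).
  by rewrite ya za ltbxx in yz.
apply: eventually_sub (eventually_and na h) => x [nxa [|]]; last by right.
by rewrite inE => /orP[/eqP/nxa//|]; left.
Qed.

(** The definable sets that hold near the end of [E] form an ultrafilter. This is the source of the
    dichotomies below and of the types at the ends of curves. *)
Lemma dset_decided A : dset A -> decided A.
Proof.
move=> dA; have [s [P AP]] := dset_pieces b dA.
have [sP|nsP] := pselect (ev (fun x =>
    x \in s \/ exists2 q, q \in P & bound b q.1 x /\ bound (~~ b) q.2 x)).
  by left; apply: eventually_sub sP => x /AP.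
right; suff : ev (~` (fun x => x \in s \/
    exists2 q, q \in P & bound b q.1 x /\ bound (~~ b) q.2 x)).
  by apply: eventually_sub => x nx /AP.
have : forall q, q \in P -> ev (~` (fun x => bound b q.1 x /\ bound (~~ b) q.2 x)).
  move=> q qP.
  have [hq|//] := decided_and (decided_bound b q.1) (decided_bound (~~ b) q.2).
  by exfalso; apply: nsP; apply: eventually_sub hq => x ?; right; exists q.
clear -cE; elim: s P => [|a s IH] P h.
  elim: P h => [|q P IHP] h.
    by apply: eventually_all => t _ [//|[]].
  have hq : q \in q :: P by exact: mem_head.
  have {}/IHP k : forall r, r \in P ->
      ev (~` (fun x => bound b r.1 x /\ bound (~~ b) r.2 x)).
    by move=> r rP; apply: h; rewrite inE rP orbT.
  apply: eventually_sub (eventually_and (h _ hq) k) => x [nq nP] [//|[r]].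
  by rewrite inE => /orP[/eqP->//|rP ?]; apply: nP; right; exists r.
have na : ev (~` [set a]).
  have [[c Ec ha]|//] := decided_pt a; have [_ _ nmax] := cE.
  have [y Ey cy] := nmax _ Ec; have [z Ez yz] := nmax _ Ey.
  have /= ya := ha _ Ey cy; have /= za := ha _ Ez (ltb_trans cy yz).
  by rewrite ya za ltbxx in yz.
apply: eventually_sub (eventually_and na (IH _ h)) => x [nxa nx] [|].
  by rewrite inE => /orP[/eqP/nxa//|?]; apply: nx; left.
by move=> ?; apply: nx; right.
Qed.

End Cut.

(** [E] holds eventually along itself, so one of its intervals reaches its end; the far end of this
    interval will be the supremum of [E]. *)
Lemma cut_piece b E : cut b E -> dset E -> exists lo hi : option M,
  (forall x, bound b lo x -> bound (~~ b) hi x -> E x) /\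
  (forall c, E c -> exists t, [/\ ltb b c t, bound b lo t & bound (~~ b) hi t]).
Proof.
move=> cE dE; have [s [P EP]] := dset_pieces b dE.
have [|[lo hi] /= qP hq] := decided_pieces cE (s := s) (P := P).
  by apply: (eventually_all cE) => t /EP.
exists lo, hi; split=> [x hlo hhi|c Ec].
  by apply/EP; right; exists (lo, hi).
by have [t [_ ? []]] := eventually_ex cE hq Ec; exists t.
Qed.

(** If [E] has a greatest element, it is [z]. Otherwise [E] is a cut and [z] is the far end of an
    interval cofinal in it; were that end infinite, [E] would contain [y]. Whether [z] lies in [E]
    is left open. *)
Lemma cut_sup b E : dset E -> (forall x y, ltb b x y -> E y -> E x) ->
  forall x y, E x -> ~ E y ->
  exists z, (forall t, ltb b t z -> E t) /\ (forall t, ltb b z t -> ~ E t).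
Proof.
move=> dE down x y Ex nEy.
have [[m Em mM]|nmax] := pselect (exists2 m, E m & forall t, E t -> ~~ ltb b m t).
  exists m; split=> [t /down|t mt Et]; first exact.
  by have := mM _ Et; rewrite mt.
have cE : cut b E.
  split=> //; first by exists x.
  move=> m Em; apply: contrapT => nm; apply: nmax; exists m => // t Et.
  by apply/negP => mt; apply: nm; exists t.
have [lo [[z|] [sub cof]]] := cut_piece cE dE; have [t [xt lot hit]] := cof _ Ex.
  exists z; split=> [u uz|u zu Eu].
    have [ut|->|tu] := ltb_total b u t.
    - exact: down ut (sub _ lot hit).
    - exact: sub.
    - apply: sub; last by rewrite /= ltbN.
      by move: lot; case: (lo) => //= w /ltb_trans; exact.
  have [v [uv _]] := cof _ Eu.
  by rewrite /= ltbN => /(ltb_trans uv)/(ltb_trans zu); rewrite ltbxx.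
exfalso; apply: nEy; have [yt|->|ty] := ltb_total b y t.
- exact: down yt (sub _ lot hit).
- exact: sub.
- by apply: sub => //; move: lot; case: (lo) => //= w /ltb_trans; exact.
Qed.

(** Needed because the domain of a definable curve has to be given as an [interval]. *)
Lemma cut_itv b E c0 : cut b E -> dset E -> E c0 -> exists I : interval M,
  itv_open_ends I /\ forall t, t \in I <-> E t /\ ltb b c0 t.
Proof.
move=> cE dE Ec0; have [_ down nmax] := cE.
have [[y nEy]|allE] := pselect (exists y, ~ E y); last first.
  exists (if b then `]c0, +oo[ else `]-oo, c0[)%O; split; first by case: (b).
  have allE' t : E t by apply: contrapT => nt; apply: allE; exists t.
  by move=> t; rewrite /ltb; case: (b); rewrite in_itv /= ?andbT; split=> // -[].
have [z [Ez nEz]] := cut_sup dE down Ec0 nEy.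
exists (if b then `]c0, z[ else `]z, c0[)%O; split; first by case: (b).
have EP t : E t <-> ltb b t z.
  split=> [Et|]; last exact: Ez.
  have [u Eu tu] := nmax _ Et.
  have [//|tz|/nEz//] := ltb_total b t z; by rewrite tz in tu; have := nEz _ tu.
move=> t; rewrite EP /ltb; case: (b); rewrite in_itv /= .
  by split=> [/andP[]|[-> ->]].
by split=> [/andP[]|[-> ->]].
Qed.

Definition germ b x A : Prop :=
  exists2 w, ltb b x w & forall t, ltb b x t -> ltb b t w -> A t.

(** On the side [b] of [x], coming closer to [x] means moving in the direction [~~ b]. *)
Lemma germ_eventually b x A : germ b x A <-> eventually_at (~~ b) [set t | ltb b x t] A.
Proof.
split=> -[w xw h]; exists w => // t xt; have := h t xt; rewrite ltbN; exact.
Qed.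

Lemma cut_gt b x : cut (~~ b) [set t | ltb b x t].
Proof.
have -> : [set t | ltb b x t] = [set t | ltb (~~ b) t x]; last exact: cut_lt.
by apply/predeqP => t /=; rewrite ltbN.
Qed.

Lemma germ_decided b x A : dset A -> germ b x A \/ germ b x (~` A).
Proof. by move=> dA; rewrite !germ_eventually; exact: (dset_decided (cut_gt b x) dA). Qed.

Lemma germ_ex b x y A : germ b x A -> ltb b x y ->
  exists t, [/\ ltb b x t, ltb b t y & A t].
Proof.
move=> [w xw h] xy; have [t [xt tw ty]] := ltb_dense2 xw xy.
by exists t; split=> //; exact: h.
Qed.

Lemma germ_and b x A B : germ b x A -> germ b x B -> germ b x (A `&` B).
Proof. by rewrite !germ_eventually; exact: eventually_and. Qed.

Lemma germ_sub b x A B : A `<=` B -> germ b x A -> germ b x B.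
Proof. by move=> AB [w xw h]; exists w => // t xt tw; exact/AB/h. Qed.

Lemma eventually_itv b x A p : ltb b p x -> eventually_at b [set t | ltb b t x] A ->
  exists q, [/\ ~~ ltb b q p, ltb b q x & forall t, ltb b q t -> ltb b t x -> A t].
Proof.
move=> px [c cx h]; have [pc|pc] := boolP (ltb b p c).
  by exists c; split=> // [|t ct tx]; [exact: ltb_asym|exact: h].
exists p; split=> // [|t pt tx]; first by rewrite ltbxx.
by apply: h => //; exact: le_ltb_trans pt.
Qed.

(** Only the end [p] moves, so the lemma can be applied to several sets in a row while [q] remains
    an end of the interval. *)
Lemma dset_itv b A p q : dset A -> ltb b p q ->
  exists p', [/\ ~~ ltb b p' p, ltb b p' q &
    (forall t, ltb b p' t -> ltb b t q -> A t) \/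
    (forall t, ltb b p' t -> ltb b t q -> ~ A t)].
Proof.
move=> dA pq; have [/(eventually_itv pq)|/(eventually_itv pq)] :=
  dset_decided (cut_lt b q) dA.
- by move=> [p' [? ? ?]]; exists p'; split=> //; left.
- by move=> [p' [? ? ?]]; exists p'; split=> //; right.
Qed.

(** By hypothesis no interval lies inside [A], which leaves only the isolated points of its
    decomposition. *)
Lemma dset_finite b A : dset A ->
  (forall p q, ltb b p q -> exists x, [/\ ltb b p x, ltb b x q & ~ A x]) ->
  exists s : seq M, forall x, A x -> x \in s.
Proof.
move=> dA nA; have [s [P AP]] := dset_pieces b dA.
exists s => x /AP[//|[[lo hi] qP [/= lox hix]]].
have [y xy yP] : exists2 y, ltb b x y &
    forall t, ltb b t y -> bound (~~ b) hi t.
  case: hi hix qP => [w|] /= xw qP; last first.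
    by have [y xy] := ltb_unbounded b x; exists y.
  by rewrite ltbN in xw; exists w => // t; rewrite ltbN.
have [t [xt ty []]] := nA _ _ xy; apply/AP; right; exists (lo, hi) => //=.
split; last exact: yP.
by move: lox; case: (lo) => //= w /ltb_trans; exact.
Qed.

End Tameness.

(** * Continuity of definable unary functions *)

Section Monotonicity.
Context {d : Order.disp_t} {M : orderTopologicalType d} {L : language}.
Variables (S : structure L M) (S_omin : o_minimal S).
Variables (f : M -> M) (f_def : dfun S f).
Implicit Types (x y z p q : M) (b c : bool).
Let dense := ltb_dense S_omin.

(** Monotonicity passes from germs to the interval by a supremum argument: if the values were beyond
    [f x] only up to [z], the germ before [z] would include [z] itself and the germ after [z] would
    lead past it. *)
Lemma local_strict_mono b c p q :
  (forall x, ltb b p x -> ltb b x q -> germ b x [set t | ltb c (f x) (f t)]) ->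
  (forall x, ltb b p x -> ltb b x q -> germ (~~ b) x [set t | ltb c (f t) (f x)]) ->
  forall x y, ltb b p x -> ltb b x y -> ltb b y q -> ltb c (f x) (f y).
Proof.
move=> hr hl x y px xy yq; apply: contrapT => nxy.
pose E : set M := [set t | forall s, ltb b x s -> ~~ ltb b t s -> ltb c (f x) (f s)].
have dE : dset S E by rewrite /dset /E /=; dfn.
have Ex : E x by move=> s ->.
have nEy : ~ E y by move=> /(_ y xy); rewrite ltbxx => /(_ isT).
have down t u : ltb b t u -> E u -> E t.
  move=> tu Eu s xs ts; apply: Eu => //; apply/negP => us.
  by have := ltb_trans tu us; exact/negP.
have [z [Ez nEz]] := cut_sup S_omin dE down Ex nEy.
have xz : ~~ ltb b z x by apply/negP => /nEz.
have zy : ~~ ltb b y z by apply/negP => /Ez.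
have pz : ltb b p z by exact: ltb_le_trans px xz.
have zq : ltb b z q by exact: le_ltb_trans zy yq.
have [Lz|nLz] := pselect (E z).
  have zy' : ltb b z y.
    by have [//|zy'|yz] := ltb_total b z y; [rewrite -zy' in nEy|rewrite yz in zy].
  have [w zw hw] := hr z pz zq.
  have [t [zt tw ty]] := ltb_dense2 S_omin zw zy'.
  apply: (nEz t zt) => s xs ts; have [sz|zs] := boolP (ltb b z s); last exact: Lz.
  have fzs : ltb c (f z) (f s) by apply: hw => //; exact: le_ltb_trans tw.
  have [xz'|xz'|zx] := ltb_total b x z; last by rewrite zx in xz.
    by apply: ltb_trans fzs; apply: Lz => //; rewrite ltbxx.
  by rewrite xz'.
have xz' : ltb b x z.
  by have [//|xz'|zx] := ltb_total b x z; [rewrite xz' in Ex|rewrite zx in xz].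
have Exs s : ltb b x s -> ltb b s z -> ltb c (f x) (f s).
  by move=> xs /Ez; apply=> //; rewrite ltbxx.
apply: nLz => s xs zs; have [sz|sz|zs'] := ltb_total b s z.
- exact: Exs.
- have zx : ltb (~~ b) z x by rewrite ltbN.
  have [t [zt tx /= ht]] := germ_ex S_omin (hl z pz zq) zx.
  rewrite sz; apply: ltb_trans ht; apply: Exs; by rewrite -ltbN.
- by rewrite zs' in zs.
Qed.

(* A drop in the direction [b] is a rise in the direction [~~ b]: a local minimum
   at every point would produce both at a common point. *)
Definition drop b c v : Prop := exists u w, [/\ ltb b u v, ltb b v w &
  forall y z, ltb b u y -> ltb b y v -> ltb b v z -> ltb b z w -> ltb c (f z) (f y)].

(* After [B], the set of points from which [f] stays above its value, has been
   left, every [x] has a last point [v] beyond which [f] stays below [f x]; as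
   [v] is a local minimum, [f] is above [f x] just before [v]. *)
Lemma local_min_drop b c p q : ltb b p q ->
  (forall e x, ltb b p x -> ltb b x q -> germ e x [set t | ltb c (f x) (f t)]) ->
  exists p', [/\ ~~ ltb b p' p, ltb b p' q &
    forall v, ltb b p' v -> ltb b v q -> drop b c v].
Proof.
move=> pq lmin.
have dB : dset S [set x | forall y, ltb b x y -> ltb b y q -> ltb c (f x) (f y)].
  by rewrite /dset /=; dfn.
have [p1 [pp1 p1q [allB|noB]]] := dset_itv S_omin dB pq.
  exfalso; have [x [p1x xq]] := dense p1q.
  have p1x' : ltb (~~ b) x p1 by rewrite ltbN.
  have [t [xt tp1 /= ft]] :=
    germ_ex S_omin (lmin (~~ b) x (le_ltb_trans pp1 p1x) xq) p1x'.
  rewrite ltbN in xt; rewrite ltbN in tp1.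
  have := allB t tp1 (ltb_trans xt xq) x xt xq => /=.
  by apply/negP; exact: ltb_asym.
have {}noB x : ltb b p1 x -> ltb b x q ->
    exists y, [/\ ltb b x y, ltb b y q & ~~ ltb c (f x) (f y)].
  move=> p1x xq; apply: contrapT => ny; apply: (noB _ p1x xq) => y xy yq.
  by apply: contrapT => nf; apply: ny; exists y; split=> //; exact/negP.
have {}lmin e x : ltb b p1 x -> ltb b x q -> germ e x [set t | ltb c (f x) (f t)].
  by move=> p1x; apply: lmin; exact: le_ltb_trans p1x.
(* Otherwise [f] is above [f x] near [q], in the sense of [c]; let [z] be the supremum of the points
   whose value is not above [f x]. If [f z] is above [f x], the local minimum at [z] forbids such
   values just before [z]. If not, [noB] gives a later value not above [f z], hence not above
   [f x]. *)
have below x : ltb b p1 x -> ltb b x q ->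
    exists2 w, ltb b w q & forall t, ltb b w t -> ltb b t q -> ~~ ltb c (f x) (f t).
  move=> p1x xq.
  have dA : dset S [set t | ltb c (f x) (f t)] by rewrite /dset /=; dfn.
  have [|[w /= wq hw]] := dset_decided S_omin (cut_lt S_omin b q) dA; last first.
    by exists w => // t wt tq; apply/negP; exact: hw.
  move=> [w /= wq hw]; exfalso.
  pose E : set M := [set t | exists y, [/\ ltb b x y, ltb b y q, ~~ ltb b y t
    & ~~ ltb c (f x) (f y)]].
  have dE : dset S E.
    apply: (@dpred_ext _ _ _ _ (fun rho => exists y, (ltb b x y /\ ltb b y q) /\
      (~~ ltb b y (rho 0) /\ ~~ ltb c (f x) (f y)))); last by dfn.
    by move=> rho; split=> [[y [[? ?] [? ?]]]|[y [? ? ? ?]]]; exists y.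
  have [y [xy yq fy]] := noB x p1x xq.
  have Ey : E y by exists y; rewrite ltbxx.
  have nEq : ~ E q by move=> [u [_ -> ]].
  have down s u : ltb b s u -> E u -> E s.
    move=> su [r [? ? rs ?]]; exists r; split=> //.
    by apply/negP => rs'; rewrite (ltb_trans rs' su) in rs.
  have [z [Ez nEz]] := cut_sup S_omin dE down Ey nEq.
  have zy : ~~ ltb b z y by apply/negP => /nEz.
  have xz : ltb b x z by exact: ltb_le_trans zy.
  have zq : ltb b z q.
    apply: le_ltb_trans wq; apply/negP => wz.
    have [t [wt tz]] := dense wz; have [u [_ uq ut /negP]] := Ez _ tz.
    by apply; exact: hw uq (ltb_le_trans wt ut).
  have p1z := ltb_trans p1x xz.
  have right_z u : ltb b z u -> ltb b u q -> ltb c (f x) (f u).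
    move=> zu uq; apply: contrapT => nf; apply: (nEz _ zu); exists u.
    by rewrite ltbxx; split=> //; [exact: ltb_trans zu|exact/negP].
  have [fxz|fxz] := boolP (ltb c (f x) (f z)).
    have zx : ltb (~~ b) z x by rewrite ltbN.
    have [t0 zt0 ht0] := lmin (~~ b) z p1z zq.
    have [t [zt tt0 tx]] := ltb_dense2 S_omin zt0 zx.
    rewrite ltbN in zt; have [u [xu uq ut fu]] := Ez _ zt.
    have [uz|uz|zu] := ltb_total b u z.
    - have /= fzu : ltb c (f z) (f u).
        by apply: ht0; rewrite ltbN //; apply: ltb_le_trans ut; rewrite -ltbN.
      by rewrite (ltb_trans fxz fzu) in fu.
    - by rewrite uz fxz in fu.
    - by rewrite (right_z _ zu uq) in fu.
  have [u [zu uq fu]] := noB z p1z zq.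
  have := right_z u zu uq; apply/negP.
  apply/negP => fxu; move/negP: fu; apply.
  exact: le_ltb_trans fxu.
have [dr0 dr] : dset S (drop b c) /\ (forall x, ltb b p1 x -> ltb b x q ->
    exists v, [/\ ltb b x v, ltb b v q & drop b c v]).
  split.
    apply: (@dpred_ext _ _ _ _ (fun rho => exists u w, ltb b u (rho 0) /\
      (ltb b (rho 0) w /\ forall y z, ltb b u y -> ltb b y (rho 0) ->
        ltb b (rho 0) z -> ltb b z w -> ltb c (f z) (f y)))); last by dfn.
    by move=> rho; split=> [[u [w [? [? ?]]]]|[u [w [? ? ?]]]]; exists u, w.
  move=> x p1x xq; have [w wq hw] := below x p1x xq.
  pose E : set M := [set t | exists y, [/\ ltb b x y, ltb b y q, ~~ ltb b y t
    & ltb c (f x) (f y)]].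
  have dE : dset S E.
    apply: (@dpred_ext _ _ _ _ (fun rho => exists y, (ltb b x y /\ ltb b y q) /\
      (~~ ltb b y (rho 0) /\ ltb c (f x) (f y)))); last by dfn.
    by move=> rho; split=> [[y [[? ?] [? ?]]]|[y [? ? ? ?]]]; exists y.
  have [y [xy yq fy]] := germ_ex S_omin (lmin b x p1x xq) xq.
  have Ey : E y by exists y; rewrite ltbxx.
  have nEq : ~ E q by move=> [u [_ -> ]].
  have down s u : ltb b s u -> E u -> E s.
    move=> su [r [? ? rs ?]]; exists r; split=> //.
    by apply/negP => rs'; rewrite (ltb_trans rs' su) in rs.
  have [v [Ev nEv]] := cut_sup S_omin dE down Ey nEq.
  have vy : ~~ ltb b v y by apply/negP => /nEv.
  have xv : ltb b x v by exact: ltb_le_trans vy.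
  have vq : ltb b v q.
    apply: le_ltb_trans wq; apply/negP => wv.
    have [t [wt tv]] := dense wv; have [u [_ uq ut fu]] := Ev _ tv.
    by have := hw _ (ltb_le_trans wt ut) uq; rewrite fu.
  have p1v := ltb_trans p1x xv.
  have right_v u : ltb b v u -> ltb b u q -> ~~ ltb c (f x) (f u).
    move=> vu uq; apply/negP => fu; apply: (nEv _ vu); exists u.
    by rewrite ltbxx; split=> //; exact: ltb_trans vu.
  exists v; split=> //.
  have fxv : ~~ ltb c (f x) (f v).
    apply/negP => fxv; have [t [vt tq /= ft]] := germ_ex S_omin (lmin b v p1v vq) vq.
    by have := right_v t vt tq; rewrite (ltb_trans fxv ft).
  have dA : dset S [set t | ltb c (f x) (f t)] by rewrite /dset /=; dfn.
  have [[u vu hu]|[u vu hu]] := germ_decided S_omin (~~ b) v dA; last first.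
    exfalso; rewrite ltbN in vu; have [t [ut tv]] := dense vu.
    have [s [xs sq st fs]] := Ev _ tv.
    have us : ltb b u s by exact: ltb_le_trans st.
    have [sv|sv|vs] := ltb_total b s v.
    - by apply: (hu s) => //; rewrite ltbN.
    - by rewrite -sv fs in fxv.
    - by have := right_v _ vs sq; rewrite fs.
  exists u, q; rewrite -ltbN; split=> // s t us sv vt tq.
  apply: (le_ltb_trans (right_v t vt tq)).
  by apply: hu; rewrite ltbN.
(* Every point has a drop point after it, so the case without drop points near [q] is impossible. *)
have [p2 [p1p2 p2q [alld|nod]]] := dset_itv S_omin dr0 p1q.
  exists p2; split=> //; apply/negP => p2p.
  by rewrite (ltb_le_trans p2p pp1) in p1p2.
exfalso; have [x [p2x xq]] := dense p2q.
have [v [xv vq /nod]] := dr x (le_ltb_trans p1p2 p2x) xq.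
by apply=> //; exact: ltb_trans xv.
Qed.

Lemma no_local_min b c p q : ltb b p q ->
  ~ (forall e x, ltb b p x -> ltb b x q -> germ e x [set t | ltb c (f x) (f t)]).
Proof.
move=> pq lmin; have [p' [pp' p'q dr]] := local_min_drop pq lmin.
have qp' : ltb (~~ b) q p' by rewrite ltbN.
have [|q' [qq' q'p' dr']] := local_min_drop (c := c) qp'.
  by move=> e x; rewrite !ltbN => ? ?; apply: lmin => //; exact: le_ltb_trans pp' _.
have [v [q'v vp']] := dense q'p'.
have [u' [w' [u'v vw' h']]] := dr' v q'v vp'.
have [u [w [uv vw h]]] : drop b c v.
  apply: dr; first by rewrite -ltbN.
  by rewrite -ltbN; apply: le_ltb_trans q'v.
rewrite !ltbN in u'v vw'.
have uv' : ltb (~~ b) v u by rewrite ltbN.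
have w'v : ltb (~~ b) v w' by rewrite ltbN.
have [y [yv uy wy]] := ltb_dense2 S_omin uv' w'v.
have [z [vz zw zu]] := ltb_dense2 S_omin vw u'v.
have := ltb_trans (h y z _ _ vz zw) (h' z y _ _ yv wy).
rewrite ltbxx !ltbN; rewrite !ltbN in yv uy; by move/(_ uy yv zu vz).
Qed.

(** Past a point with value [a], a strictly monotone function never meets [a] again, so the list
    loses an element. *)
Lemma strict_mono_infinite b c (s : seq M) p q : ltb b p q ->
  (forall x y, ltb b p x -> ltb b x y -> ltb b y q -> ltb c (f x) (f y)) ->
  ~ (forall x, ltb b p x -> ltb b x q -> f x \in s).
Proof.
elim: s p => [|a s IH] p pq mono fs.
  by have [x [px xq]] := dense pq; have := fs x px xq.
have [[x [px xq fxa]]|na] := pselect (exists x, [/\ ltb b p x, ltb b x q & f x = a]).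
  apply: (IH x xq) => [y z xy|y xy yq]; first by apply: mono; exact: ltb_trans xy.
  have := fs y (ltb_trans px xy) yq; rewrite inE => /orP[/eqP fya|//].
  by have := mono x y px xy yq; rewrite fxa fya ltbxx.
apply: (IH p pq mono) => x px xq; have := fs x px xq.
by rewrite inE => /orP[/eqP fxa|//]; exfalso; apply: na; exists x.
Qed.

(** Continuity in the order topology, split along the half-lines around [f x] and the sides of [x].
    In this form it is first-order, so the set of such points is definable. *)
Definition germ_continuous x : Prop := forall c y, ltb c y (f x) ->
  forall b, germ b x [set t | ltb c y (f t)].

(** On the side where [f] moves away from [y], monotonicity is enough. On the other side a value
    between [y] and [f x] is attained, and its preimage bounds the germ; [y1] marks how far values
    are known to be attained. *)
Lemma strict_mono_half b c p q y1 x :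
  (forall x y, ltb b p x -> ltb b x y -> ltb b y q -> ltb c (f x) (f y)) ->
  ltb b p x -> ltb b x q -> ltb c y1 (f x) ->
  (forall y, ltb c y1 y -> ltb c y (f x) ->
    exists x', [/\ ltb b p x', ltb b x' q & f x' = y]) ->
  forall y, ltb c y (f x) -> forall e, germ e x [set t | ltb c y (f t)].
Proof.
move=> mono px xq y1x im y yx e; have [->|eb] := eqVneq e b.
  by exists q => // t xt tq; apply: ltb_trans yx _; exact: mono.
have -> : e = ~~ b by move: eb; case: (e) (b) => -[].
have yx' : ltb (~~ c) (f x) y by rewrite ltbN.
have y1x' : ltb (~~ c) (f x) y1 by rewrite ltbN.
have [r [xr ry ry1]] := ltb_dense2 S_omin yx' y1x'; rewrite !ltbN in xr ry ry1.
have [x' [px' xq' fx']] := im _ ry1 xr; exists x'.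
  rewrite ltbN; have [//|xx'|xx'] := ltb_total b x' x.
    by rewrite -fx' xx' ltbxx in xr.
  by have := ltb_trans xr (mono _ _ px xx' xq'); rewrite fx' ltbxx.
move=> t; rewrite !ltbN => tx x't /=; apply: ltb_trans ry _; rewrite -fx'.
by apply: mono => //; exact: ltb_trans xq.
Qed.

(** The image is definable and infinite, so it contains an interval. A preimage of an inner value
    [r] has attained values on both sides of its own, which is what continuity needs. *)
Lemma strict_mono_continuous b c p q : ltb b p q ->
  (forall x y, ltb b p x -> ltb b x y -> ltb b y q -> ltb c (f x) (f y)) ->
  exists x, [/\ ltb b p x, ltb b x q & germ_continuous x].
Proof.
move=> pq mono.
pose A : set M := [set y | exists x, (ltb b p x /\ ltb b x q) /\ f x = y].
have dA : dset S A by rewrite /dset /A /=; dfn.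
have [y1 [y2 [y12 hy]]] : exists y1 y2, ltb c y1 y2 /\
    forall y, ltb c y1 y -> ltb c y y2 -> A y.
  apply: contrapT => nA; have [|s As] := dset_finite S_omin (b := c) dA.
    move=> y1 y2 y12; apply: contrapT => ny; apply: nA; exists y1, y2.
    split=> // y y1y yy2; apply: contrapT => nAy; apply: ny; by exists y.
  apply: (@strict_mono_infinite b c s p q pq mono) => x px xq.
  by apply: As; exists x.
have [r [y1r ry2]] := dense y12; have [x [[px xq] fx]] := hy r y1r ry2.
exists x; split=> // c' y.
have [->|cc'] := eqVneq c' c.
  apply: (@strict_mono_half b c p q y1) => //; first by rewrite fx.
  rewrite fx => z y1z zr; have [x' [[? ?] ?]] := hy z y1z (ltb_trans zr ry2).
  by exists x'.
have -> : c' = ~~ c by move: cc'; case: (c) (c') => -[].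
(* Reversing both the direction and the order of the values keeps [f] monotone and exchanges the two
   halves of continuity. *)
apply: (@strict_mono_half (~~ b) (~~ c) q p y2); rewrite ?fx ?ltbN //.
  by move=> u v; rewrite !ltbN => uq vu pv; exact: mono.
move=> z; rewrite !ltbN => zy2 rz.
have [x' [[? ?] ?]] := hy z (ltb_trans y1r rz) zy2.
by exists x'; rewrite !ltbN.
Qed.

Lemma dset_germ b (R : M -> M -> Prop) :
  dpred S (fun rho => R (rho 1) (rho 0)) -> dset S [set x | germ b x (R x)].
Proof.
move=> dR; rewrite /dset /germ /=.
have dR' : dpred S (fun rho => R (env_shift 1 (env_shift 1 rho) 0) (rho 0)).
  apply: (dpred_subst (Q := fun rho => R (rho 1) (rho 0))
    (s := fun rho => env_cons (rho 0) (fun=> rho 2)) _ dR).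
  by move=> -[|k]; eexists (inl _).
by dfn.
Qed.

(** Either [f] is constant on one side of some point, and continuous at points close to it there, or
    each one-sided germ lies strictly above or strictly below the value. Tameness, used once per
    side, makes the answers uniform: equal answers on the two sides are excluded by [no_local_min],
    opposite ones make [f] strictly monotone. *)
Lemma ex_germ_continuous b p q : ltb b p q ->
  exists x, [/\ ltb b p x, ltb b x q & germ_continuous x].
Proof.
wlog -> : b p q / b = true => [W|pq].
  case: b => pq; first exact: W.
  by have [//|x [qx xp cx]] := W true q p erefl; exists x.
have [[x [e [px xq [w xw hw]]]]|noeq] := pselect (exists x e,
    [/\ ltb true p x, ltb true x q & germ e x [set t | f t = f x]]).
  have [w' xw' w'pq] : exists2 w', ltb e x w' &
      forall t, ltb e x t -> ltb e t w' -> ltb true p t /\ ltb true t q.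
    case: e xw hw => xw hw; [exists q => // t xt tq|exists p => // t xt tq].
      by split=> //; exact: ltb_trans xt.
    by split=> //; exact: (@ltb_trans _ _ true _ _ _ xt xq).
  have [t [xt tw tw']] := ltb_dense2 S_omin xw xw'.
  have [pt tq] := w'pq t xt tw'.
  exists t; split=> // c y; rewrite (hw t xt tw) => yx e'.
  have [->|ee'] := eqVneq e' e.
    by exists w => // s ts sw /=; rewrite hw //; exact: ltb_trans ts.
  have -> : e' = ~~ e by move: ee'; case: (e) (e') => -[].
  exists x; first by rewrite ltbN.
  by move=> s; rewrite !ltbN => st xs /=; rewrite hw //; exact: ltb_trans tw.
have tri e c x : ltb true p x -> ltb true x q ->
    ~ germ e x [set t | ltb c (f x) (f t)] -> germ e x [set t | ltb c (f t) (f x)].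
  move=> px xq ng.
  have d1 : dset S [set t | ltb c (f x) (f t)] by rewrite /dset /=; dfn.
  have d2 : dset S [set t | f t = f x] by rewrite /dset /=; dfn.
  have [//|g1] := germ_decided S_omin e x d1.
  have [g2|g2] := germ_decided S_omin e x d2.
    by exfalso; apply: noeq; exists x, e.
  apply: germ_sub (germ_and g1 g2) => t [/= n1 n2].
  by have [|/esym|] := ltb_total c (f x) (f t).
have dg e : dset S [set x | germ e x [set t | ltb true (f x) (f t)]].
  by apply: (@dset_germ e (fun x t => ltb true (f x) (f t))); dfn.
have [p1 [pp1 p1q h1]] := dset_itv S_omin (dg true) pq.
have [p2 [p12 p2q h2]] := dset_itv S_omin (dg false) p1q.
have pp2 x : ltb true p2 x -> ltb true p1 x by exact: le_ltb_trans.
have {}pp1 x : ltb true p2 x -> ltb true p x.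
  by move=> /pp2; exact: le_ltb_trans.
have [x [p2x xq cx]] : exists x, [/\ ltb true p2 x, ltb true x q & germ_continuous x].
  case: h1 h2 => h1 [] h2.
  - exfalso; apply: (@no_local_min true true p2 q p2q) => -[] x p2x xq.
      by apply: h1 => //; exact: pp2.
    exact: h2.
  - apply: (@strict_mono_continuous true true p2 q p2q).
    apply: local_strict_mono => x p2x xq; first by apply: h1 => //; exact: pp2.
    by apply: tri => //; [exact: pp1|exact: h2].
  - apply: (@strict_mono_continuous true false p2 q p2q).
    apply: local_strict_mono => x p2x xq; last exact: h2.
    by apply: (tri true true) => //; [exact: pp1|apply: h1 => //; exact: pp2].
  - exfalso; apply: (@no_local_min true false p2 q p2q) => -[] x p2x xq.
      by apply: (tri true true) => //; [exact: pp1|apply: h1 => //; exact: pp2].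
    by apply: (tri false true) => //; [exact: pp1|exact: h2].
by exists x; split=> //; exact: pp1.
Qed.

Lemma eventually_germ_continuous b E : cut b E ->
  eventually_at b E germ_continuous.
Proof.
move=> cE; have dc : dset S germ_continuous.
  have dg c e : dset S [set x | forall y, ltb c y (f x) ->
      germ e x [set t | ltb c y (f t)]].
    by rewrite /dset /germ /=; dfn.
  apply: dpred_ext (dpred_and (dpred_and (dg true true) (dg true false))
    (dpred_and (dg false true) (dg false false))) => rho.
  split=> [[[? ?] [? ?]] [] y fy []|h]; eauto.
  by split; split=> y fy; exact: h.
have [//|[c Ec nc]] := dset_decided S_omin cE dc.
have [_ down nmax] := cE; have [t Et ct] := nmax c Ec.
have [x [cx xt hx]] := ex_germ_continuous ct.
by exfalso; apply: (nc x _ cx hx); exact: down xt Et.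
Qed.

End Monotonicity.

(** * Definability in definable spaces *)

Section DefinableFamilies.
Context {d : Order.disp_t} {M : orderTopologicalType d} {L : language}.
Context {S : structure L M}.
Variable a0 : M.
Implicit Types (X Y : defspace S).

Lemma chart_inj_in X i (x y : X) : dom X i x -> dom X i y ->
  chart X i x = chart X i y -> x = y.
Proof. by move=> xi yi; apply: (@chart_inj _ _ _ _ X i); exact: mem_set. Qed.

Lemma dom_ex X (x : X) : exists i, dom X i x.
Proof.
have : [set: X] x by []; rewrite -(@dom_cover _ _ _ _ X) => -[i _ xi]; by exists i.
Qed.

(* A relation between environments and points of [X] is definable when it is so
   in each chart, the coordinates of the point being put in front of the
   environment. *)
Definition drel X (Q : (nat -> M) -> X -> Prop) : Prop :=
  forall i, dpred S (fun rho => exists x,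
    (dom X i x /\ chart X i x = \row_(k < Defs.dim X i) rho k)%R /\
    Q (env_shift (Defs.dim X i) rho) x).
Arguments drel : clear implicits.

Lemma drel_ext X Q Q' : (forall rho x, Q rho x <-> Q' rho x) ->
  drel X Q -> drel X Q'.
Proof.
move=> QQ' h i; apply: dpred_ext (h i) => rho.
by split=> -[x [? /QQ' ?]]; exists x.
Qed.

Lemma drel_and X Q R : drel X Q -> drel X R -> drel X (fun rho x => Q rho x /\ R rho x).
Proof.
move=> hQ hR i; apply: dpred_ext (dpred_and (hQ i) (hR i)) => rho; split.
  move=> [[x [[xi xrho] Qx]] [y [[yi yrho] Ry]]]; exists x; split=> //; split=> //.
  by rewrite (chart_inj_in xi yi) // xrho.
by move=> [x [? []]]; split; exists x.
Qed.

Lemma drel_not X Q : drel X Q -> drel X (fun rho x => ~ Q rho x).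
Proof.
move=> hQ i.
have hi : dpred S (fun rho => (chart X i @` dom X i) (\row_(k < Defs.dim X i) rho k)%R).
  by apply: dpred_set (@chart_definable _ _ _ _ X i) _; simplev_tac.
apply: dpred_ext (dpred_and hi (dpred_not (hQ i))) => rho; split.
  by move=> [[x xi xrho] nQ]; exists x; split=> // Qx; apply: nQ; exists x.
move=> [x [[xi xrho] nQ]]; split; first by exists x.
move=> [y [[yi yrho] Qy]]; apply: nQ.
by rewrite (chart_inj_in xi yi) // xrho.
Qed.

Lemma drel_or X Q R : drel X Q -> drel X R -> drel X (fun rho x => Q rho x \/ R rho x).
Proof.
move=> hQ hR.
apply: drel_ext (drel_not (drel_and (drel_not hQ) (drel_not hR))) => rho x.
by rewrite not_andE !notK.
Qed.

(** Serves when coordinates have just been quantified in front of an environment whose first [m]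
    entries do not concern [Q]. *)
Lemma drel_at X Q i m : drel X Q -> dpred S (fun rho => exists x,
    (dom X i x /\ chart X i x = \row_(k < Defs.dim X i) rho k)%R /\
    Q (env_shift m (env_shift (Defs.dim X i) rho)) x).
Proof.
set n := Defs.dim X i => h.
pose s (rho : nat -> M) k := if k < n then rho k else rho (k + m).
have hs k : simple (fun rho => s rho k).
  by rewrite /s; case: (k < _); eexists (inl _).
apply: dpred_ext (dpred_subst hs (h i)) => rho.
have -> : (\row_(k < n) s rho k = \row_(k < n) rho k)%R.
  by apply/rowP => k; rewrite !mxE /s ltn_ord.
suff -> : env_shift n (s rho) = env_shift m (env_shift n rho) by [].
apply/funext => k; rewrite /env_shift /s ltnNge leq_addr /=.
by rewrite addnAC addnA.
Qed.

Lemma drel_subst X Q (s : (nat -> M) -> nat -> M) :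
  (forall k, simple (s^~ k)) -> drel X Q -> drel X (fun rho x => Q (s rho) x).
Proof.
move=> hs h i; set n := Defs.dim X i.
pose s' (rho : nat -> M) k := if k < n then rho k else s (env_shift n rho) (k - n).
have hs' k : simple (s'^~ k).
  rewrite /s'; case: (k < _); first by eexists (inl _).
  have [[j|a] hc] := hs (k - n).
    by exists (inl (n + j)); apply/funext => rho; rewrite [LHS](congr1 (@^~ _) hc).
  by exists (inr a); apply/funext => rho; rewrite [LHS](congr1 (@^~ _) hc).
apply: dpred_ext (dpred_subst hs' (h i)) => rho.
have -> : (\row_(k < n) s' rho k = \row_(k < n) rho k)%R.
  by apply/rowP => k; rewrite !mxE /s' ltn_ord.
suff -> : env_shift n (s' rho) = s (env_shift n rho) by [].
by apply/funext => k; rewrite {1}/env_shift /s' ltnNge leq_addr /= addKn.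
Qed.

(** One chart is enough for the points of [dom X j]: the graph of the transition map turns
    coordinates in any other chart into coordinates in this one. *)
Lemma drel_chart X j (P : 'rV[M]_(Defs.dim X j) -> (nat -> M) -> Prop) :
  dpred S (fun rho => P (\row_(k < Defs.dim X j) rho k)%R (env_shift (Defs.dim X j) rho)) ->
  drel X (fun rho x => dom X j x /\ P (chart X j x) rho).
Proof.
move=> hP i; have [tau [tauE tau_def _]] := @transition _ _ _ _ X i j.
set n := Defs.dim X j in hP *; set m := Defs.dim X i.
apply: (@dpred_ext _ _ _ _ (fun rho => exists v : 'rV[M]_n,
  [set row_mx x (tau x) | x in chart X i @` (dom X i `&` dom X j)]
    (row_mx (\row_(k < m) rho k)%R v) /\ P v (env_shift m rho))).
  move=> rho; split.
    move=> [v [[_ [x [xi xj] <-] /eq_row_mx[xrho xv]] Pv]]; exists x; split=> //.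
    by split=> //; rewrite -(tauE x) // xv.
  move=> [x [[xi xrho] [xj Px]]]; exists (chart X j x); split=> //.
  by exists (chart X i x); [exists x|rewrite tauE // xrho].
dfn; first by apply: dpred_set tau_def _; simplev_tac.
pose s (rho : nat -> M) k := if k < n then rho k else rho (k + m).
have hs k : simple (fun rho => s rho k).
  by rewrite /s; case: (k < _); eexists (inl _).
apply: dpred_ext (dpred_subst hs hP) => rho.
have -> : (\row_(k < n) s rho k = \row_(k < n) rho k)%R.
  by apply/rowP => k; rewrite !mxE /s ltn_ord.
suff -> : env_shift n (s rho) = env_shift m (env_shift n rho) by [].
apply/funext => k; rewrite /env_shift /s ltnNge leq_addr /=.
by rewrite addnAC addnA.
Qed.

Lemma drel_dom X j : drel X (fun _ x => dom X j x).
Proof.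
have : drel X (fun rho x => dom X j x /\ True).
  by apply: (drel_chart (P := fun _ _ => True)); exact: dpred_cst.
by apply: drel_ext => rho x; split=> [[]|].
Qed.

Lemma drel_definable_set X (A : set X) : drel X (fun=> A) <-> definable_set A.
Proof.
have E i : dpred S (fun rho => exists x,
    (dom X i x /\ chart X i x = \row_(k < Defs.dim X i) rho k)%R /\ A x) <->
    definable S (chart X i @` (A `&` dom X i)).
  rewrite -(dpredP S a0); split; apply: dpred_ext => rho.
    by split=> [[x [[? ?] ?]]|[x [? ?] ?]]; exists x.
  by split=> [[x [? ?] ?]|[x [[? ?] ?]]]; exists x.
by split=> h i; [rewrite -E; exact: h|rewrite E; exact: h].
Qed.

Lemma definable_setI X (A B : set X) :
  definable_set A -> definable_set B -> definable_set (A `&` B).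
Proof. rewrite -!drel_definable_set; exact: drel_and. Qed.

Lemma definable_setC X (A : set X) : definable_set A -> definable_set (~` A).
Proof. rewrite -!drel_definable_set; exact: drel_not. Qed.

Lemma definable_setU X (A B : set X) :
  definable_set A -> definable_set B -> definable_set (A `|` B).
Proof. rewrite -!drel_definable_set; exact: drel_or. Qed.

Lemma drel_set X (A : set X) : definable_set A -> drel X (fun=> A).
Proof. by move/drel_definable_set. Qed.

Lemma drel_family X n (T : set 'rV[M]_n) (F : 'rV[M]_n -> set X) :
  definable_set_family T F ->
  drel X (fun rho x => T (\row_(k < n) rho k)%R /\ F (\row_(k < n) rho k)%R x).
Proof.
move=> [_ hF] i; have [_ hFi] := hF i; set m := Defs.dim X i.
have := dpred_set (x := fun rho : nat -> M =>
  row_mx (\row_(k < n) env_shift m rho k) (\row_(k < m) rho k))%R hFi.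
move=> /(_ ltac:(simplev_tac)); apply: dpred_ext => rho.
rewrite /= row_mxKl row_mxKr; split.
  by move=> [? [x [? ?] ?]]; exists x.
by move=> [x [[? ?] [? ?]]]; split=> //; exists x.
Qed.

Lemma family_drel X (F : M -> set X) : drel X (fun rho x => F (rho 0) x) ->
  definable_set_family [set: 'rV[M]_1] (fun t => F (t ord0 ord0)).
Proof.
move=> hF; have dT : definable S [set: 'rV[M]_1].
  by apply/(dpredP S a0); exact: dpred_cst.
split=> // i; split=> //; apply/(dpredP S a0); set m := Defs.dim X i.
pose s (rho : nat -> M) k := if k < m then rho k.+1 else rho 0.
have hs k : simple (fun rho => s rho k).
  by rewrite /s; case: (k < _); eexists (inl _).
apply: dpred_ext (dpred_subst hs (hF i)) => rho /=.
have -> : (rsubmx (\row_(k < 1 + m) rho k) = \row_(k < m) s rho k)%R.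
  by apply/rowP => k; rewrite !mxE /s ltn_ord.
have -> : (lsubmx (\row_(k < 1 + m) rho k) ord0 ord0 = env_shift m (s rho) 0)%R.
  by rewrite !mxE /env_shift /s addn0 ltnn.
split=> [[x [[? ?] ?]]|[_ [x [? ?] ?]]]; first by split=> //; exists x.
by exists x.
Qed.

Lemma row_mx_const_eq m (t : M) (w : 'rV[M]_m) (rho : nat -> M) :
  row_mx (const_mx t : 'rV_1) w = (\row_(k < 1 + m) rho k)%R <->
  t = rho 0 /\ w = (\row_(k < m) env_shift 1 rho k)%R.
Proof.
split=> [/rowP h|[-> ->]].
  split; first by have := h (lshift m ord0); rewrite row_mxEl !mxE.
  by apply/rowP => k; have := h (rshift 1 k); rewrite row_mxEr !mxE.
by apply/rowP => k; case: (split_ordP k) => j ->;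
  rewrite ?row_mxEl ?row_mxEr !mxE // (ord1 j).
Qed.

Lemma dset_interval (I : interval M) : dset S [set` I].
Proof.
rewrite /dset /=; case: I => l r.
have hl : dpred S (fun rho => (l <= BLeft (rho 0))%O).
  case: l => [[] u|[]].
  - apply: (@dpred_ext _ _ _ _ (fun rho => ~~ ltb true (rho 0) u)); last by dfn.
    by move=> rho; rewrite /ltb bnd_simp leNgt.
  - apply: (@dpred_ext _ _ _ _ (fun rho => ltb true u (rho 0))); last by dfn.
    by move=> rho; rewrite /ltb bnd_simp.
  - by apply: dpred_ext (dpred_cst S True a0) => rho; rewrite bnd_simp.
  - by apply: dpred_ext (dpred_cst S False a0) => rho; rewrite bnd_simp.
have hr : dpred S (fun rho => (BRight (rho 0) <= r)%O).
  case: r => [[] u|[]].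
  - apply: (@dpred_ext _ _ _ _ (fun rho => ltb true (rho 0) u)); last by dfn.
    by move=> rho; rewrite /ltb bnd_simp.
  - apply: (@dpred_ext _ _ _ _ (fun rho => ~~ ltb true u (rho 0))); last by dfn.
    by move=> rho; rewrite /ltb bnd_simp leNgt.
  - by apply: dpred_ext (dpred_cst S False a0) => rho; rewrite bnd_simp.
  - by apply: dpred_ext (dpred_cst S True a0) => rho; rewrite bnd_simp.
apply: dpred_ext (dpred_and hl hr) => rho; rewrite itv_boundlr.
by split=> [[-> ->]|/andP[]].
Qed.

Definition dcurve X (I : set M) (gamma : M -> X) : Prop := forall i, definable S
  [set row_mx (const_mx t : 'rV[M]_1) (chart X i (gamma t)) |
    t in I `&` gamma @^-1` dom X i].

(** The point of the curve is reached through its coordinates [v] in some chart: the graph of the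
    curve in that chart links the parameter to [v], and [Q] is read from [v]. *)
Lemma drel_curve X I gamma Q : @dcurve X I gamma -> drel X Q ->
  dpred S (fun rho => I (rho 0) /\ Q (env_shift 1 rho) (gamma (rho 0))).
Proof.
move=> hg hQ.
apply: (@dpred_ext _ _ _ _ (fun rho => exists i, exists v : 'rV[M]_(Defs.dim X i),
  [set row_mx (const_mx t : 'rV[M]_1) (chart X i (gamma t)) |
    t in I `&` gamma @^-1` dom X i] (row_mx (const_mx (rho 0)) v) /\
  (exists x, (dom X i x /\ chart X i x = v) /\ Q (env_shift 1 rho) x))).
  move=> rho; split.
    move=> [i [v [[t [It ti] /eq_row_mx[/rowP/(_ ord0) tr tv]] [x [[xi xv] Qx]]]]].
    rewrite !mxE in tr; rewrite -tr; split=> //.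
    by rewrite (@chart_inj_in X i (gamma t) x) // tv.
  move=> [It Qt]; have [i ti] := dom_ex (gamma (rho 0)).
  exists i, (chart X i (gamma (rho 0))); split; first by exists (rho 0).
  by exists (gamma (rho 0)).
apply: (dpred_fin a0) => i; dfn; last exact: (drel_at i 1 hQ).
by apply: dpred_set (hg i) _; simplev_tac.
Qed.

Lemma dcurveP X (I : set M) (gamma : M -> X) :
  (forall i, dpred S (fun rho => I (rho 0) /\ (dom X i (gamma (rho 0)) /\
    chart X i (gamma (rho 0)) = \row_(k < Defs.dim X i) env_shift 1 rho k)%R)) ->
  dcurve I gamma.
Proof.
move=> h i; apply/(dpredP S a0); apply: dpred_ext (h i) => rho; split.
  by move=> [It [ti trho]]; exists (rho 0) => //; apply/row_mx_const_eq.
by move=> [t [It ti] /row_mx_const_eq[<- <-]].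
Qed.

Lemma drel_map X Y (f : X -> Y) Q : definable_map f -> drel Y Q ->
  drel X (fun rho x => Q rho (f x)).
Proof.
move=> hf hQ i; set n := Defs.dim X i.
apply: (@dpred_ext _ _ _ _ (fun rho => exists j, exists w : 'rV[M]_(Defs.dim Y j),
  [set row_mx (chart X i x) (chart Y j (f x)) |
      x in dom X i `&` f @^-1` dom Y j] (row_mx (\row_(k < n) rho k)%R w) /\
  (exists y, (dom Y j y /\ chart Y j y = w) /\ Q (env_shift n rho) y))).
  move=> rho; split.
    move=> [j [w [[x [xi xj] /eq_row_mx[xrho xw]] [y [[yj yw] Qy]]]]].
    exists x; split=> //; rewrite (@chart_inj_in Y j (f x) y) //.
    by rewrite xw.
  move=> [x [[xi xrho] Qx]]; have [j xj] := dom_ex (f x).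
  exists j, (chart Y j (f x)); split; last by exists (f x).
  by exists x => //; rewrite xrho.
apply: (dpred_fin a0) => j; dfn; last exact: (drel_at j n hQ).
by apply: dpred_set (hf i j) _; simplev_tac.
Qed.

Lemma definable_preimage X Y (f : X -> Y) (A : set Y) : definable_map f ->
  definable_set A -> definable_set (f @^-1` A).
Proof.
move=> hf; rewrite -!drel_definable_set => hA.
exact: drel_map hf hA.
Qed.

Lemma drel_chart_eq X j (v : (nat -> M) -> 'rV[M]_(Defs.dim X j)) :
  simplev v -> drel X (fun rho x => dom X j x /\ chart X j x = v rho).
Proof.
move=> hv; set n := Defs.dim X j in v hv *.
apply: (drel_chart (P := fun w rho => w = v rho)).
apply: (@dpred_ext _ _ _ _ (fun rho => ~ exists k : 'I_n,
    rho k <> v (env_shift n rho) ord0 k)).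
  move=> rho; split=> [h|h [k]].
    apply/rowP => k; rewrite mxE; apply: contrapT => nk; apply: h; by exists k.
  by rewrite -h mxE.
apply: dpred_not; apply: (dpred_fin a0) => k; apply: dpred_not.
apply: dpred_eq_simple; first exact: simple_var.
have [[i|a] hc] := hv k.
  exists (inl (n + i)); apply/funext => rho.
  by rewrite [LHS](congr1 (@^~ (env_shift n rho)) hc).
by exists (inr a); apply/funext => rho; rewrite [LHS](congr1 (@^~ (env_shift n rho)) hc).
Qed.

Lemma dcurve_comp X Y (f : X -> Y) I gamma : definable_map f ->
  @dcurve X I gamma -> @dcurve Y I (f \o gamma).
Proof.
move=> hf hg; apply: dcurveP => j.
have := drel_map hf (drel_chart_eq (X := Y) (j := j)
  (v := fun rho => \row_(k < Defs.dim Y j) rho k)%R ltac:(simplev_tac)).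
by move=> /(drel_curve hg).
Qed.

End DefinableFamilies.

(** * Monotone families of open sets and limits of types *)

Section Charts.
Context {d : Order.disp_t} {M : orderTopologicalType d} {L : language}.
Variables (S : structure L M) (S_omin : o_minimal S) (X : defspace S).

Lemma open_ltb b (u : M) : open [set t | ltb b u t].
Proof.
case: b; rewrite /ltb.
  have -> : [set t | (u < t)%O] = [set` `]u, +oo[%O].
    by apply/predeqP => t; rewrite /= in_itv /= andbT.
  exact: rray_open.
have -> : [set t | (t < u)%O] = [set` `]-oo, u[%O].
  by apply/predeqP => t; rewrite /= in_itv.
exact: lray_open.
Qed.

Lemma nbhs_ltb b (u t : M) : ltb b u t -> nbhs t [set s | ltb b u s].
Proof. by move=> ut; apply: open_nbhs_nbhs; split=> //; exact: open_ltb. Qed.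

Lemma germ_nbhs (t : M) (A : set M) :
  germ true t A -> germ false t A -> A t -> nbhs t A.
Proof.
move=> [w tw hw] [u ut hu] At.
apply: (filterS (P := [set s | ltb true u s] `&` [set s | ltb false w s])).
  move=> s /= [us sw]; have [st|->//|ts] := ltb_total true s t; [exact: hu|exact: hw].
by apply: filterI; exact: nbhs_ltb.
Qed.

Lemma nbhs_germ b (t : M) (A : set M) : nbhs t A -> germ b t A.
Proof.
rewrite itv_nbhsE => -[I [oI tI] IA].
have [w tw hw] : exists2 w, ltb b t w & forall s, ltb b t s -> ltb b s w -> s \in I.
  move: oI tI; rewrite /ltb; case: I {IA} => [[[]u|[]] [[]w|[]]] //= _;
    rewrite in_itv /= ?andbT; case: b => tI.
  - case/andP: tI => ut tw; exists w => // s ts sw.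
    by rewrite in_itv /= sw (lt_trans ut ts).
  - case/andP: tI => ut tw; exists u => // s ts sw.
    by rewrite in_itv /= sw (lt_trans ts tw).
  - have [w tw] := ltb_unbounded S_omin true t; exists w => // s ts sw.
    by rewrite in_itv /= (lt_trans tI ts).
  - by exists u => // s ts sw; rewrite in_itv /= sw.
  - by exists w => // s ts sw; rewrite in_itv /= sw.
  - have [u tu] := ltb_unbounded S_omin false t; exists u => // s ts sw.
    by rewrite in_itv /= (lt_trans ts tI).
  - by have [w tw] := ltb_unbounded S_omin true t; exists w => // s ts sw; rewrite in_itv.
  - by have [w tw] := ltb_unbounded S_omin false t; exists w => // s ts sw; rewrite in_itv.
by exists w => // s ts sw; exact/IA/hw.
Qed.

(** [e true k] is a lower bound and [e false k] an upper bound for the coordinate [k]. These boxes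
    form a base of definable open sets, which links arbitrary neighborhoods with limits of types,
    where only definable open sets are tested. *)
Definition chart_box j (e : bool -> 'I_(Defs.dim X j) -> M) : set X :=
  [set x | dom X j x /\ forall b k, ltb b (e b k) (chart X j x ord0 k)].

Lemma chart_box_open j e : open (@chart_box j e).
Proof.
have sub : chart_box e `<=` dom X j by move=> x [].
apply/(open_chartP sub).
exists [set v : 'rV[M]_(Defs.dim X j) | forall b k, ltb b (e b k) (v ord0 k)].
- rewrite openE => v hv.
  exists (fun _ k => [set t | ltb true (e true k) t] `&` [set t | ltb false (e false k) t]).
    by move=> i k; rewrite (ord1 i); apply: filterI; apply: nbhs_ltb; exact: hv.
  by move=> w hw [] k; have [] := hw ord0 k.
- apply/predeqP => v; split.
    by move=> [x [xj hx] <-]; split=> //; exists x.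
  by move=> [[x xj <-] hx]; exists x.
Qed.

Lemma nbhs_chart_box j (x : X) (U : set X) : dom X j x -> nbhs x U ->
  exists e, @chart_box j e x /\ chart_box e `<=` U.
Proof.
move=> xj; rewrite nbhsE => -[W [oW Wx] WU].
have oWj : open (W `&` dom X j) by apply: openI => //; exact: open_dom.
have [V oV VE] := (open_chartP (@subIsetr _ W (dom X j))).1 oWj.
have Vx : V (chart X j x).
  suff : (chart X j @` dom X j `&` V) (chart X j x) by case.
  by rewrite -VE; exists x.
have [P PV PsV] : nbhs (chart X j x) V by exact: open_nbhs_nbhs.
have he (bk : bool * 'I_(Defs.dim X j)) : exists u, ltb bk.1 u (chart X j x ord0 bk.2) /\
    forall t, ltb bk.1 u t -> ltb (~~ bk.1) (chart X j x ord0 bk.2) t -> P ord0 bk.2 t.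
  have [w tw hw] := nbhs_germ (~~ bk.1) (PV ord0 bk.2).
  exists w; split=> [|t wt tx]; first by rewrite -ltbN.
  by apply: hw => //; rewrite ltbN.
have [e hE] := choice he; exists (fun b k => e (b, k)).
split; first by split=> // b k; have [] := hE (b, k).
move=> y [yj hy]; apply: WU; suff : (W `&` dom X j) y by case.
have : (chart X j @` dom X j `&` V) (chart X j y).
  split; first by exists y.
  apply: PsV => i k; rewrite (ord1 i).
  have [yx|->|xy] := ltb_total true (chart X j y ord0 k) (chart X j x ord0 k).
  - exact: (hE (true, k)).2 _ (hy true k) yx.
  - exact: nbhs_singleton (PV ord0 k).
  - exact: (hE (false, k)).2 _ (hy false k) xy.
rewrite -VE => -[z [Wz zj]] zy; split=> //.
by rewrite -(chart_inj_in zj yj zy).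
Qed.

End Charts.

(** * Definable compactness for monotone families of open sets *)

Section ClosedFamilies.
Context {d : Order.disp_t} {M : orderTopologicalType d} {L : language}.
Variables (S : structure L M) (S_omin : o_minimal S).
Variables (S_skolem : has_definable_skolem S) (X : defspace S).

Lemma cut_upper b (E : set M) (I : finType) (g : I -> M) : cut b E ->
  (forall i, E (g i)) -> exists2 c, E c & forall i, ltb b (g i) c.
Proof.
move=> cE hg; have [[c0 Ec0] _ _] := cE.
suff H (s : seq I) : eventually_at b E [set t | forall i, i \in s -> ltb b (g i) t].
  have [t [Et _ ht]] := eventually_ex cE (H (enum I)) Ec0.
  by exists t => // i; apply: ht; rewrite mem_enum.
elim: s => [|i s IH]; first by exists c0.
have hi : eventually_at b E [set t | ltb b (g i) t] by exists (g i).
apply: eventually_sub (eventually_and hi IH) => t [it st] j.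
by rewrite inE => /orP[/eqP->|/st].
Qed.

(** Unfolds to [right_end] for [true] and to [left_end] for [false]. *)
Definition end_filter b (I : interval M) : set_system M := eventually_at b [set` I].

Lemma completable_end (K : set X) I gamma b : completable K I gamma ->
  exists2 x, K x & gamma @ end_filter b I --> x.
Proof. by move=> [l r]; case: b; [exact: r|exact: l]. Qed.

(** Skolem functions choose tuples of elements of [M], so points of [X] are chosen inside a single
    chart [j]. *)
Lemma definable_selection j (a0 : M) (E : set M) (F : M -> set X) :
  dset S E -> drel (fun rho x => F (rho 0) x) ->
  (forall c, E c -> exists2 x, dom X j x & F c x) ->
  exists sigma : 'rV[M]_1 -> 'rV[M]_(Defs.dim X j),
    definable_fun S [set t : 'rV[M]_1 | E (t ord0 ord0)] sigma /\
    forall c, E c -> exists x, [/\ dom X j x, F c x & chart X j x = sigma (const_mx c)].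
Proof.
move=> dE dF hF.
have dT : definable S [set t : 'rV[M]_1 | E (t ord0 ord0)].
  by apply/(dpredP S a0); apply: dpred_ext dE => rho /=; rewrite mxE.
have [_ /(_ j)[_ dFj]] := family_drel a0 dF.
have [||sigma [ds hs]] := S_skolem (T := [set t : 'rV[M]_1 | E (t ord0 ord0)])
    (F := fun t => chart X j @` (F (t ord0 ord0) `&` dom X j)).
- split=> //; apply/(dpredP S a0); set m := Defs.dim X j in dFj *.
  have h1 := dpred_set (x := fun rho : nat -> M =>
    lsubmx (\row_(k < 1 + m) rho k)%R) dT ltac:(simplev_tac).
  have h2 := dpred_set (x := fun rho : nat -> M =>
    (\row_(k < 1 + m) rho k)%R) dFj ltac:(simplev_tac).
  by apply: dpred_ext (dpred_and h1 h2) => rho; split=> [[? []]|[]].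
- by move=> t /= /hF[x xj Fx]; exists (chart X j x), x.
exists sigma; split=> // c Ec.
have [|x [Fx xj] xs] := hs (const_mx c); first by rewrite /= mxE.
by rewrite mxE in Fx; exists x.
Qed.

Lemma monotone_open_cover (K : set X) b (E : set M) (G : M -> set X) :
  definable_set K -> definably_compact K -> cut b E -> dset S E ->
  (forall c, E c -> open (G c)) ->
  (forall c c', E c' -> ltb b c c' -> G c `<=` G c') ->
  drel (fun rho x => G (rho 0) x) ->
  (forall c, E c -> exists2 x, K x & ~ G c x) ->
  exists2 x, K x & forall c, E c -> ~ G c x.
Proof.
move=> dK cK cE dE oG incG dG exG.
have [[a0 Ea0] down nmax] := cE.
(* If each of the finitely many charts lacked such a point for some parameter, all of them would
   lack one for a later parameter by monotonicity, against [exG]. *)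
have [j hj] : exists j, forall c, E c -> exists2 x, dom X j x & K x /\ ~ G c x.
  apply: contrapT => nj.
  have /choice[g hg] (j : 'I_(nchart X)) : exists c, E c /\
      ~ exists2 x, dom X j x & K x /\ ~ G c x.
    apply: contrapT => nc; apply: nj; exists j => c Ec.
    by apply: contrapT => nx; apply: nc; exists c.
  have [c Ec gc] := cut_upper cE (fun j => (hg j).1).
  have [x Kx Gx] := exG c Ec; have [j xj] := dom_ex x.
  by apply: (hg j).2; exists x => //; split=> // /(incG _ _ Ec (gc j)).
set n := Defs.dim X j.
have [sigma [dsigma hsigma]] : exists sigma : 'rV[M]_1 -> 'rV[M]_n,
    definable_fun S [set t : 'rV[M]_1 | E (t ord0 ord0)] sigma /\
    forall c, E c -> exists x, [/\ dom X j x, K x /\ ~ G c x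
      & chart X j x = sigma (const_mx c)].
  apply: (@definable_selection j a0 E (fun c => [set x | K x /\ ~ G c x])) => //.
  apply: (drel_and (Q := fun=> K) (R := fun rho x => ~ G (rho 0) x)).
    exact (drel_set a0 dK).
  exact: drel_not.
have /choice[s hs] t : exists x, E t ->
    [/\ dom X j x, K x, ~ G t x & chart X j x = sigma (const_mx t)].
  have [Et|nEt] := pselect (E t).
    by have [x [? [? ?] ?]] := hsigma t Et; exists x.
  by have [x _] := hsigma a0 Ea0; exists x.
have [Gr GrE] : exists Gr : M -> 'rV[M]_n -> Prop,
    forall t v, Gr t v <-> E t /\ sigma (const_mx t) = v.
  by exists (fun t v => E t /\ sigma (const_mx t) = v).
have graph (v : (nat -> M) -> 'rV[M]_n) (t : (nat -> M) -> M) :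
    simplev v -> simple t -> dpred S (fun rho => Gr (t rho) (v rho)).
  move=> hv ht.
  have := dpred_set (x := fun rho => row_mx (const_mx (t rho)) (v rho)) dsigma
    (simplev_row_mx (simplev_const ht) hv).
  apply: dpred_ext => rho; rewrite GrE; split.
    move=> [u Eu /eq_row_mx[ut sv]]; rewrite ut in Eu sv.
    by rewrite /= mxE in Eu.
  by move=> [Et sv]; exists (const_mx (t rho)); rewrite /= ?mxE ?sv.
(* The coordinates get the default value [a0] off [E], as the continuity results concern total
   functions; only points of [E] matter near its end. *)
pose f k t := if pselect (E t) then sigma (const_mx t) ord0 k else a0.
have df k : dfun S (f k).
  apply: (@dpred_ext _ _ _ _ (fun rho =>
    (exists v : 'rV[M]_n, Gr (rho 0) v /\ v ord0 k = rho 1) \/ (~ E (rho 0) /\ a0 = rho 1))).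
    move=> rho; rewrite /f; case: pselect => Et; split.
    - by move=> [[v [/GrE[_ ->]]]|[]].
    - by left; exists (sigma (const_mx (rho 0))); rewrite GrE.
    - by move=> [[v [/GrE[]]]|[]].
    - by right.
  have dE' : dpred S (fun rho => E (rho 0)) by exact: dE.
  by dfn; apply: graph; [simplev_tac|eexists (inl _)].
have /choice[g hg] k : exists c, E c /\
    forall t, E t -> ltb b c t -> germ_continuous (f k) t.
  by have [c ? ?] := eventually_germ_continuous S_omin (df k) cE; exists c.
(* Past [c0] all coordinates are continuous, so the curve is taken on the part of [E] beyond
   [c0]. *)
have [c0 Ec0 gc0] := cut_upper cE (fun k => (hg k).1).
have [I [oI IP]] := cut_itv S_omin cE dE Ec0.
have IE t : t \in I -> E t by move=> /IP[].
have curve : definable_curve K I s.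
  split=> //.
  - by have [t Et ct] := nmax _ Ec0; exists t; apply/IP.
  - by move=> t /IE Et; have [] := hs t Et.
  - rewrite continuous_open_subspace; last exact: itv_open_ends_open.
    move=> t /set_mem /= tI; have [Et ct] := (IP t).1 tI.
    have [tj _ _ st] := hs t Et.
    move=> U /(nbhs_chart_box S_omin tj)[e [[_ he] eU]].
    have nI : nbhs t [set` I] by apply: open_nbhs_nbhs; split=> //; exact: itv_open_ends_open.
    have near k : nbhs t [set u | E u -> forall c, ltb c (e c k) (chart X j (s u) ord0 k)].
      have fE u : E u -> chart X j (s u) ord0 k = f k u.
        by move=> Eu; rewrite /f; case: pselect => // ?; have [_ _ _ ->] := hs u Eu.
      have hc c : nbhs t [set u | ltb c (e c k) (f k u)].
        have ft : ltb c (e c k) (f k t) by rewrite -fE.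
        by apply: germ_nbhs => //; apply: (hg k).2 => //; exact: ltb_trans (gc0 k) ct.
      apply: filterS (filterI (hc true) (hc false)) => u [/= h1 h2] Eu.
      by rewrite fE // => -[].
    have nall : nbhs t [set u | forall k, E u ->
        forall c, ltb c (e c k) (chart X j (s u) ord0 k)].
      exact: filter_forall near.
    apply: filterS (filterI nI nall) => u [/= uI hu].
    have Eu := IE _ uI; have [uj _ _ _] := hs u Eu.
    by apply: eU; split=> // c k; exact: hu.
  - apply: (dcurveP a0) => i; have dI := dset_interval (S := S) a0 I.
    apply: (@dpred_ext _ _ _ _ (fun rho => rho 0 \in I /\
      exists v : 'rV[M]_n, Gr (rho 0) v /\
      exists x, (dom X j x /\ chart X j x = v) /\
        (dom X i x /\ chart X i x = \row_(k < Defs.dim X i) env_shift 1 rho k)%R)).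
      move=> rho; split.
        move=> [tI [v [/GrE[Et sv] [x [[xj xv] hx]]]]]; split=> //.
        have [tj _ _ st] := hs _ Et.
        by rewrite (chart_inj_in tj xj) // st xv.
      move=> [tI ht]; split=> //; have Et := IE _ tI; have [tj _ _ st] := hs _ Et.
      by exists (sigma (const_mx (rho 0))); rewrite GrE; split=> //; exists (s (rho 0)).
    dfn.
      by apply: graph; [simplev_tac|eexists (inl _)].
    apply: (drel_at j 1 (Q := fun rho x => dom X i x /\
      chart X i x = \row_(k < Defs.dim X i) rho k)%R).
    by apply: (drel_chart_eq a0); simplev_tac.
have [x Kx sx] := completable_end b (cK _ _ curve).
exists x => // c Ec Gx.
(* If [x] were in the open set [G c], so would be [s u] for all [u] far enough, in particular for
   one beyond [c]; then [s u] is in [G u] by monotonicity, against its choice. *)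
have [t0 /= t0I ht0] : end_filter b I (s @^-1` G c).
  by apply: sx; apply: open_nbhs_nbhs; split=> //; exact: oG.
have [Et0 c0t0] := (IP t0).1 t0I.
have [u Eu hu] := cut_upper cE (g := fun e : bool => if e then c else t0)
  ltac:(by case).
have [_ _ nG _] := hs u Eu; apply: nG; apply: (incG _ _ Eu (hu true)).
apply: (ht0 u _ (hu false)); apply/IP; split=> //.
exact: ltb_trans (hu false).
Qed.

End ClosedFamilies.

(** * Limits of definable types that contain a definably compact set *)

Section TypeLimits.
Context {d : Order.disp_t} {M : orderTopologicalType d} {L : language}.
Variables (S : structure L M) (S_omin : o_minimal S).
Variables (S_skolem : has_definable_skolem S) (X : defspace S).
Variables (alpha : set_system X) (alpha_def : definable_type alpha).
Let alphaP := definable_type_on alpha_def.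

Lemma type_bigI (I : finType) (A : I -> set X) :
  (forall i, alpha (A i)) -> alpha [set x | forall i, A i x].
Proof.
move=> hA; suff H (s : seq I) : exists2 B, alpha B &
    forall x, B x <-> forall i, i \in s -> A i x.
  have [B aB BP] := H (enum I).
  have <- : B = [set x | forall i, A i x]; last exact: aB.
  apply/predeqP => x; rewrite BP; split=> h i; last by move=> _; exact: h.
  by apply: h; rewrite mem_enum.
elim: s => [|i s [B aB BP]]; first by exists setT; [exact: typeT alphaP|].
exists (A i `&` B); first exact: (typeI alphaP).
move=> x; split=> [[Ax /BP Bx] k|h].
  by rewrite inE => /orP[/eqP->|/Bx].
split; first by apply: h; exact: mem_head.
by apply/BP => k ks; apply: h; rewrite inE ks orbT.
Qed.

Lemma type_setC (A : set X) : definable_set A -> ~ alpha A -> alpha (~` A).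
Proof. by move=> dA nA; have [|] := type_ultra alphaP dA. Qed.

Lemma type_setCF (A : set X) : alpha A -> alpha (~` A) -> False.
Proof.
move=> aA aC; apply: (type0 alphaP); rewrite -(setICr A).
exact: (typeI alphaP).
Qed.

Section Compact.
Variables (a0 : M) (K : set X) (alphaK : alpha K) (cK : definably_compact K).
Let dK : definable_set K := type_definable alphaP alphaK.

Definition half j b (k : 'I_(Defs.dim X j)) (c : M) : set X :=
  [set x | dom X j x /\ ltb b (chart X j x ord0 k) c].

Lemma half_drel j b k : drel (fun rho => @half j b k (rho 0)).
Proof.
apply: (drel_chart (P := fun v rho => ltb b (v ord0 k) (rho 0))).
by dfn.
Qed.

Lemma half_definable j b k c : definable_set (@half j b k c).
Proof.
apply/(drel_definable_set a0).
apply: (drel_chart (P := fun v rho => ltb b (v ord0 k) c)).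
by dfn.
Qed.

Lemma half_open j b k c : open (@half j b k c).
Proof.
have sub : @half j b k c `<=` dom X j by move=> x [].
apply/(open_chartP sub); exists [set v | ltb b (v ord0 k) c].
  rewrite openE => v vc.
  exists (fun _ l => if l == k then [set t | ltb (~~ b) c t] else setT).
    move=> i l; rewrite (ord1 i); case: eqP => [->|_]; last exact: filterT.
    by apply: nbhs_ltb; rewrite ltbN.
  by move=> w /(_ ord0 k); rewrite eqxx /= ltbN.
apply/predeqP => v; split.
  by move=> [x [xj hx] <-]; split=> //; exists x.
by move=> [[x xj <-] hx]; exists x.
Qed.

Lemma half_sub j b k c c' : ltb b c c' -> @half j b k c `<=` half b k c'.
Proof. by move=> cc' x [xj xc]; split=> //; exact: ltb_trans cc'. Qed.

Definition small j b k : set M := [set c | ~ alpha (@half j b k c)].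

(** This is where definability of [alpha] enters: the half-spaces form a uniformly definable family
    with parameter [c]. *)
Lemma small_dset j b k : dset S (@small j b k).
Proof.
have [T [dT _ hT]] := definable_type_def alpha_def
  (@family_drel _ _ _ _ a0 X (@half j b k) (half_drel b k)).
have := dpred_set (x := fun rho : nat -> M => const_mx (rho 0)) dT
  ltac:(simplev_tac).
move=> /dpred_not; apply: dpred_ext => rho.
by rewrite /small /= -hT // mxE.
Qed.

Lemma small_down j b k c c' : ltb b c c' -> @small j b k c' -> small b k c.
Proof.
move=> cc' nc' ac; apply: nc'; apply: (typeS alphaP) ac; last exact: half_sub.
exact: half_definable.
Qed.

(** The index is a chart, a direction and a coordinate. Each half-space in the union is outside of
    [alpha], but the union may belong to it. *)
Definition small_half (i : {j : 'I_(nchart X) & (bool * 'I_(Defs.dim X j))%type}) :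
    set X :=
  [set x | exists2 c, small (tagged i).1 (tagged i).2 c
                    & half (tagged i).1 (tagged i).2 c x].

Lemma small_half_open i : open (small_half i).
Proof.
have -> : small_half i = \bigcup_(c in small (tagged i).1 (tagged i).2)
    half (tagged i).1 (tagged i).2 c.
  by apply/predeqP => x.
by apply: bigcup_open => c _; exact: half_open.
Qed.

Lemma small_half_definable i : definable_set (small_half i).
Proof.
apply/(drel_definable_set a0); case: i => j [b k].
have : drel (fun rho x => dom X j x /\
    exists c, small b k c /\ ltb b (chart X j x ord0 k) c).
  apply: (drel_chart (P := fun v rho => exists c, small b k c /\ ltb b (v ord0 k) c)).
  dfn; apply: (dpred_subst (Q := fun rho => small b k (rho 0))
    (s := fun rho => env_cons (rho 0) (fun=> rho 0)) _ (small_dset b k)).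
  by move=> -[|l]; eexists (inl _).
apply: drel_ext => rho x; split.
  by move=> [xj [c [sc xc]]]; exists c.
by move=> [c sc [xj xc]]; split=> //; exists c.
Qed.

Lemma avoid_small_halves (s : seq {j : 'I_(nchart X) & (bool * 'I_(Defs.dim X j))%type})
    (G : set X) :
  open G -> definable_set G -> ~ alpha G ->
  exists2 x, K x & ~ G x /\ forall i, i \in s -> ~ small_half i x.
Proof.
elim: s G => [|i s IH] G oG dG nG.
  have /(typeI alphaP alphaK) aKG := type_setC dG nG.
  apply: contrapT => nx; apply: (type0 alphaP).
  suff <- : K `&` ~` G = set0 by [].
  by apply/predeqP => x; split=> // -[Kx Gx]; apply: nx; exists x.
move: i => [j [b k]].
have unionP c : small b k c -> [/\ open (G `|` half b k c),
    definable_set (G `|` half b k c) & ~ alpha (G `|` half b k c)].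
  move=> sc; have dh := half_definable b k c; split.
  - by apply: openU => //; exact: half_open.
  - exact: (definable_setU a0).
  - move=> aU; apply: (type_setCF aU); rewrite setCU.
    by apply: (typeI alphaP); exact: type_setC.
have [[c0 sc0]|nosmall] := pselect (exists c, @small j b k c); last first.
  have [x Kx [Gx hx]] := IH G oG dG nG; exists x => //; split=> // i.
  rewrite inE => /orP[/eqP-> [c /= sc _]|]; last exact: hx.
  by apply: nosmall; exists c.
(* With a greatest parameter [m] the union is the single half-space at [m], which can be added to
   [G] at once. *)
have [[m sm mM]|nmax] := pselect (exists2 m, @small j b k m &
    forall c, small b k c -> ~~ ltb b m c).
  have [oU dU nU] := unionP m sm.
  have [x Kx [Ux hx]] := IH _ oU dU nU; exists x => //; split.
    by move=> Gx; apply: Ux; left.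
  move=> i; rewrite inE => /orP[/eqP-> [c /= sc [xj xc]]|]; last exact: hx.
  by apply: Ux; right; split=> //; exact: ltb_le_trans (mM _ sc).
have cs : cut b (@small j b k).
  split; first by exists c0.
    by move=> x y; exact: small_down.
  move=> c sc; apply: contrapT => nc; apply: nmax; exists c => // c' sc'.
  by apply/negP => cc'; apply: nc; exists c'.
(* [R] is fixed while [c] varies: the induction hypothesis for [G] enlarged by the half-space at [c]
   says that this set together with [R] does not cover [K]. Compactness then lets [c] run over all
   of [small b k]. *)
pose R : set X := [set x | exists2 i, i \in s & small_half i x].
have oR : open R.
  have -> : R = \bigcup_(i in [set` s]) small_half i by apply/predeqP.
  by apply: bigcup_open => i _; exact: small_half_open.
have dR : definable_set R.
  rewrite /R; elim: (s) => [|i s' IHs].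
    have -> : [set x | exists2 i, i \in [::] & small_half i x] = ~` [set: X].
      by apply/predeqP => x; split=> [[]|/(_ Logic.I)].
    by apply: (definable_setC a0); exact: type_definable (typeT alphaP).
  have -> : [set x | exists2 l, l \in i :: s' & small_half l x] =
      small_half i `|` [set x | exists2 l, l \in s' & small_half l x].
    apply/predeqP => x; split.
      move=> [l]; rewrite inE => /orP[/eqP->|ls'] xl; first by left.
      by right; exists l.
    move=> [xi|[l ls' xl]]; first by exists i => //; exact: mem_head.
    by exists l => //; rewrite inE ls' orbT.
  by apply: (definable_setU a0) => //; exact: small_half_definable.
have [||||x Kx hx] := @monotone_open_cover _ _ _ S S_omin S_skolem X K b
    (small b k) (fun c => G `|` half b k c `|` R) dK cK cs (small_dset b k).
- by move=> c sc; apply: openU => //; have [] := unionP c sc.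
- by move=> c c' _ cc' x [[Gx|/(half_sub cc')]|]; [left; left|left; right|right].
- apply: drel_or; last exact: (drel_set a0 dR).
  apply: (drel_or (Q := fun=> G)); first exact: (drel_set a0 dG).
  exact: half_drel.
- move=> c sc; have [oU dU nU] := unionP c sc.
  have [x Kx [Ux hx]] := IH _ oU dU nU; exists x => // -[//|[i si]].
  exact: hx.
exists x => //; split.
  by move=> Gx; apply: (hx c0 sc0); left; left.
move=> i; rewrite inE => /orP[/eqP-> [c sc xc]|si xi].
  by apply: (hx c sc); left; right.
by apply: (hx c0 sc0); right; exists i.
Qed.

(* A point of [K] outside of all the small half-spaces, and outside of the
   chart domains not in [alpha], has the same cuts as [alpha] in its charts. *)
Lemma type_limit_compact : exists x, type_limit alpha x.
Proof.
(* Avoiding [O] ensures that every chart domain containing the point found belongs to [alpha]. *)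
pose O : set X := [set x | exists j, ~ alpha (dom X j) /\ dom X j x].
have ddom j : definable_set (dom X j) by apply/(drel_definable_set a0); exact: drel_dom.
have nO : alpha (~` O).
  have : alpha [set x | forall j, (if pselect (alpha (dom X j)) then setT
      else ~` dom X j) x].
    apply: type_bigI => j; case: pselect => h; first exact: typeT alphaP.
    exact: type_setC.
  suff -> : ~` O = [set x | forall j, (if pselect (alpha (dom X j)) then setT
      else ~` dom X j) x] by [].
  apply/predeqP => x; split=> [nOx j|h [j [nj xj]]].
    by case: pselect => // nj xj; apply: nOx; exists j.
  by have := h j; case: pselect.
have oO : open O.
  have -> : O = \bigcup_(j in [set j | ~ alpha (dom X j)]) dom X j.
    by apply/predeqP => x; split=> [[j []]|[j]]; exists j.
  by apply: bigcup_open => j _; exact: open_dom.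
have dO : definable_set O.
  by rewrite -(setCK O); apply: (definable_setC a0); exact: type_definable nO.
have [x Kx [Ox hx]] := avoid_small_halves
  (enum {: {j : 'I_(nchart X) & (bool * 'I_(Defs.dim X j))%type}}) oO dO
  (fun aO => type_setCF aO nO).
exists x => U oU dU Ux; have [j xj] := dom_ex x.
have aj : alpha (dom X j) by apply: contrapT => nj; apply: Ox; exists j.
have [e [[_ he] eU]] := nbhs_chart_box S_omin xj (open_nbhs_nbhs (conj oU Ux)).
(* The face of the box given by [b] and [k] bounds the half-space with flag [~~ b] at [e b k], which
   contains [x]; were it not in [alpha], it would be part of a [small_half]. *)
have ah : alpha [set y | forall bk : bool * 'I_(Defs.dim X j),
    half (~~ bk.1) bk.2 (e bk.1 bk.2) y].
  apply: type_bigI => -[b k] /=; apply: contrapT => nh.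
  have := hx (Tagged (fun j => (bool * 'I_(Defs.dim X j))%type) (~~ b, k)).
  rewrite mem_enum; apply=> //; exists (e b k) => //=; split=> //.
  by rewrite ltbN.
apply: (typeS alphaP) dU _ (typeI alphaP aj ah) => y [yj hy].
apply: eU; split=> // b k; have [_] := hy (b, k).
by rewrite /= ltbN.
Qed.

End Compact.
End TypeLimits.

(** * The type at the end of a curve *)

Section CurveTypes.
Context {d : Order.disp_t} {M : orderTopologicalType d} {L : language}.
Variables (S : structure L M) (S_omin : o_minimal S) (X : defspace S).

Lemma family_fiber (a0 : M) n (T : set 'rV[M]_n) (F : 'rV[M]_n -> set X) t :
  definable_set_family T F -> T t -> definable_set (F t).
Proof.
move=> /drel_family hF Tt; apply/(drel_definable_set a0).
pose s (rho : nat -> M) := env_row t (fun=> a0).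
have hs k : simple (s^~ k) by exists (inr (s (fun=> a0) k)).
apply: drel_ext (drel_subst hs hF) => rho x.
have -> : (\row_(k < n) s rho k = t)%R.
  by apply/rowP => k; rewrite mxE /s /env_row valK.
by split=> [[]|].
Qed.

Lemma chart_box_definable (a0 : M) j e : definable_set (@chart_box _ _ _ _ X j e).
Proof.
apply/(drel_definable_set a0).
apply: (drel_chart (P := fun v _ => forall b k, ltb b (e b k) (v ord0 k))).
apply: (@dpred_ext _ _ _ _ (fun rho => ~ exists bk : bool * 'I_(Defs.dim X j),
  ~ ltb bk.1 (e bk.1 bk.2) (rho bk.2))).
  move=> rho; split=> [h c k|h [[c k] /=]]; last by have := h c k; rewrite mxE.
  by rewrite mxE; apply: contrapT => nh; apply: h; exists (c, k).
by apply: dpred_not; apply: (dpred_fin a0) => bk; dfn.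
Qed.

Lemma interval_convex b (I : interval M) c u t :
  c \in I -> u \in I -> ltb b c t -> ~~ ltb b u t -> t \in I.
Proof.
case: I b => l r [] /=; rewrite /ltb -leNgt !itv_boundlr
  => /andP[lc cr] /andP[lu ur] ct tu; apply/andP; split.
- by apply: le_trans lc _; rewrite bnd_simp ltW.
- by apply: le_trans ur; rewrite bnd_simp.
- by apply: le_trans lu _; rewrite bnd_simp.
- by apply: le_trans cr; rewrite bnd_simp ltW.
Qed.

Section EndType.
Variables (a0 : M) (b : bool) (I : interval M) (gamma : M -> X).
Hypotheses (oI : itv_open_ends I) (I0 : [set` I] !=set0).
Hypothesis gamma_def : dcurve [set` I] gamma.
Local Notation ev := (end_filter b I).

(** [I] need not be an initial segment; adding all points that precede one of its points gives a cut
    with the same end, to which the dichotomy applies. Openness of [I] excludes a greatest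
    element. *)
Lemma end_cut : cut b [set t | exists2 u, u \in I & ~~ ltb b u t].
Proof.
split.
- by have [u Iu] := I0; exists u, u; rewrite // ltbxx.
- move=> x y xy [u uI yu]; exists u => //; apply/negP => ux.
  by rewrite (ltb_trans ux xy) in yu.
- move=> x [u uI xu].
  have nI : nbhs u [set` I].
    by apply: open_nbhs_nbhs; split=> //; exact: itv_open_ends_open.
  have [w uw] := ltb_unbounded S_omin b u.
  have [t [ut _ tI]] := germ_ex S_omin (nbhs_germ S_omin b nI) uw.
  by exists t; [exists t; rewrite ?ltbxx|exact: le_ltb_trans ut].
Qed.

Lemma end_filterE A :
  ev A <-> eventually_at b [set t | exists2 u, u \in I & ~~ ltb b u t] A.
Proof.
split=> [[c cI hc]|[c [u uI cu] hc]].
  exists c; first by exists c; rewrite ?ltbxx.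
  by move=> t [u uI tu] ct; apply: hc => //; exact: interval_convex ct tu.
exists u => // t tI ut; apply: hc; first by exists t; rewrite ?ltbxx.
exact: le_ltb_trans ut.
Qed.

Definition end_type : set_system X :=
  [set A | definable_set A /\ ev (gamma @^-1` A)].

Lemma end_all (A : set M) : (forall t, t \in I -> A t) -> ev A.
Proof. by move=> h; have [c cI] := I0; exists c => // t /h. Qed.

Lemma end_ex A : ev A -> exists2 t, t \in I & A t.
Proof.
move=> evA; have [u uI] := I0.
have [t [tI _ At]] : exists t, [/\ t \in I, ltb b u t & A t].
  have [c cI hc] := evA; have [_ _ nmax] := end_cut.
  have [|t [v vI tv] ct] := nmax c; first by exists c; rewrite ?ltbxx.
  have [|t' [v' vI' tv'] ut'] := nmax u; first by exists u; rewrite ?ltbxx.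
  have [tt'|tt'|tt'] := ltb_total b t t'.
  - exists t'; split=> //; first exact: interval_convex ut' tv'.
    apply: hc; first exact: interval_convex ut' tv'.
    exact: ltb_trans tt'.
  - rewrite -tt' in ut' tv'; exists t; split=> //; first exact: interval_convex ut' tv'.
    apply: hc => //; exact: interval_convex ut' tv'.
  - exists t; split=> //; first exact: interval_convex ct tv.
      exact: ltb_trans tt'.
    by apply: hc => //; exact: interval_convex ct tv.
by exists t.
Qed.

(** The dichotomy at the end of [I] gives an ultrafilter, and lying eventually in a member of a
    definable family is a first-order condition on its parameter. *)
Lemma end_type_definable : definable_type end_type.
Proof.
have evI A B : ev A -> ev B -> ev (A `&` B) by exact: eventually_and.
have evS A B : A `<=` B -> ev A -> ev B by exact: eventually_sub.
split.
  split=> [A []|||A B [dA hA] [dB hB]|A B dB AB [dA hA]|A dA] //.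
  - split; last exact: end_all.
    by move=> i; rewrite setTI; exact: chart_definable.
  - by move=> [_ /end_ex[]].
  - by split; [exact: (definable_setI a0)|exact: evI].
  - by split=> //; apply: evS hA => t; exact: AB.
  - have dgA : dset S ([set` I] `&` gamma @^-1` A).
      have := drel_curve a0 gamma_def (drel_set a0 dA).
      by apply: dpred_ext.
    have := dset_decided S_omin end_cut dgA; rewrite /decided -!end_filterE.
    move=> [h|h]; first by left; split=> //; apply: evS h => t [].
    right; split; first exact: (definable_setC a0).
    have hI : ev [set` I] by exact: end_all.
    by apply: evS (evI _ _ hI h) => t [tI nt] At; apply: nt.
move=> n T F TF; exists [set t | T t /\ end_type (F t)]; split.
- have hF := drel_curve a0 gamma_def (drel_family TF).
  have dT := TF.1.
  apply/(dpredP S a0).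
  (* The conditions on [u] and [T] are repeated inside so that the inner formula has exactly the
     form given by [drel_family] and [drel_curve]. *)
  apply: (@dpred_ext _ _ _ _ (fun rho => T (\row_(k < n) rho k)%R /\
    exists c, c \in I /\ forall u, u \in I -> ltb b c u ->
      (u \in I /\ (T (\row_(k < n) rho k)%R /\ F (\row_(k < n) rho k)%R (gamma u))))).
    move=> rho; split.
      move=> [Tr [c [cI hc]]]; split=> //; split; first exact: (family_fiber a0 TF).
      by exists c => // u uI cu; have [_ []] := hc u uI cu.
    move=> [Tr [_ [c cI hc]]]; split=> //; exists c; split=> // u uI cu.
    by split=> //; split=> //; exact: hc.
  have dI (t : (nat -> M) -> M) : simple t -> dpred S (fun rho => t rho \in I).
    move=> ht; apply: (dpred_subst (Q := fun rho => rho 0 \in I)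
      (s := fun rho => env_cons (t rho) (fun=> t rho)) _ (dset_interval a0 I)).
    by move=> -[|k].
  have dF : dpred S (fun rho => rho 0 \in I /\
      (T (\row_(k < n) env_shift 2 rho k)%R /\
       F (\row_(k < n) env_shift 2 rho k)%R (gamma (rho 0)))).
    apply: (dpred_subst (Q := fun rho => rho 0 \in I /\
        (T (\row_(k < n) env_shift 1 rho k)%R /\
         F (\row_(k < n) env_shift 1 rho k)%R (gamma (rho 0))))
      (s := fun rho => env_cons (rho 0) (env_shift 2 rho)) _ hF).
    by move=> -[|k]; eexists (inl _).
  apply: dpred_and; first by apply: dpred_set dT _; simplev_tac.
  apply: (@dpred_ex _ _ _ _ (fun c rho => c \in I /\ forall u, u \in I -> ltb b c u ->
      (u \in I /\ (T (\row_(k < n) rho k)%R /\ F (\row_(k < n) rho k)%R (gamma u))))).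
  apply: dpred_and; first by apply: dI; eexists (inl _).
  apply: (@dpred_all _ _ _ _ (fun u rho => u \in I -> ltb b (rho 0) u ->
      (u \in I /\ (T (\row_(k < n) env_shift 1 rho k)%R /\
       F (\row_(k < n) env_shift 1 rho k)%R (gamma u))))).
  apply: dpred_imp; first by apply: dI; eexists (inl _).
  by apply: dpred_imp; [dfn|exact: dF].
- by move=> t [].
- by move=> t Tt; split=> [|[]].
Qed.

(** Convergence concerns all neighborhoods and a limit of a type only definable open sets; the
    definable boxes bridge the gap. *)
Lemma end_type_limit x : type_limit end_type x -> gamma @ ev --> x.
Proof.
move=> hx U nU; have [j xj] := dom_ex x.
have [e [ex eU]] := nbhs_chart_box S_omin xj nU.
have [_ h] := hx _ (chart_box_open e) (chart_box_definable a0 e) ex.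
by apply: eventually_sub h => t; exact: eU.
Qed.

End EndType.
End CurveTypes.

Theorem theorem5p3 (d : Order.disp_t) (M : orderTopologicalType d)
    (L : language) (S : structure L M)
    (S_omin : o_minimal S) (S_skolem : has_definable_skolem S)
    (X Y : defspace S)
    (X_hausdorff : hausdorff_space X) (Y_hausdorff : hausdorff_space Y)
    (Y_lcompact : locally_definably_compact Y)
    (f : X -> Y) (f_cont : continuous f) (f_def : definable_map f) :
  definably_proper f <->
  (forall alpha : set_system X, definable_type alpha ->
    (exists y : Y, type_limit (type_map f alpha) y) ->
    exists x : X, type_limit alpha x).
Proof.
have [a0 _] := omin_nonempty S_omin; split.
  move=> f_proper alpha alpha_def [y fy].
  (* A box around [y] inside [K] belongs to the image type, so the preimage of [K], which is
     definably compact, belongs to [alpha]. *)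
  have [K [nK dK cK]] := Y_lcompact y.
  have [dfK cfK] := f_proper K dK cK; have [j yj] := dom_ex y.
  have [e [ey eK]] := nbhs_chart_box S_omin yj nK.
  apply: (type_limit_compact S_omin S_skolem alpha_def a0 _ cfK).
  have [_ h] := fy _ (chart_box_open e) (chart_box_definable a0 e) ey.
  by apply: (typeS (definable_type_on alpha_def)) h => // x /eK.
move=> lim K dK cK; have dfK := definable_preimage a0 f_def dK.
split=> // I gamma [oI I0 inK cgamma dgamma].
have fcurve : definable_curve K I (f \o gamma).
  split=> //; last exact: (dcurve_comp a0 f_def dgamma).
  by move=> t U nU; exact: (cgamma t _ (f_cont _ _ nU)).
suff H b : exists2 x, (f @^-1` K) x & gamma @ end_filter b I --> x.
  by split; [exact: (H false)|exact: (H true)].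
(* The limit [y] of the image curve is a limit of the image of the end type, and the hypothesis
   yields [x]. By continuity [f x] is also a limit of the image curve; uniqueness of limits in [Y]
   gives [f x = y], so [x] lies over [K]. *)
have [y Ky fy] := completable_end b (cK _ _ fcurve).
have [x hx] : exists x, type_limit (end_type b I gamma) x.
  apply: lim; first exact: (end_type_definable S_omin a0).
  exists y => U oU dU Uy; split=> //; split; first exact: definable_preimage.
  by apply: fy; exact: open_nbhs_nbhs.
have gx := end_type_limit S_omin a0 hx.
exists x => //=; suff -> : f x = y by [].
apply: Y_hausdorff => A B nA nB.
have hA : end_filter b I ((f \o gamma) @^-1` A) by exact: (gx _ (f_cont x A nA)).
have hB : end_filter b I ((f \o gamma) @^-1` B) by exact: (fy B nB).
have [t _ [At Bt]] := end_ex S_omin oI I0 (eventually_and hA hB).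
by exists (f (gamma t)).
Qed.
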